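(* Let $f>1$ be an integer and $\eta>1$ a real number. For the packing strategy of Harmonic-Stretch for the $(f,\eta)$-fault-tolerant bin packing problem, there is an adjustment strategy (a rule that promotes standby replicas to primary replicas and demotes them back to standby as bins fail and recover) that ensures that, for every online input and every pattern of bin failures and recoveries with at most $f$ bins failed at any time, the packing of Harmonic-Stretch stays valid: a primary replica of each item is always present in a non-failed bin (with no bin being overloaded).
   Context: **Problem.** Let $f>1$ be an integer and $\eta>1$ real. In the $(f,\eta)$-fault-tolerant bin packing problem, a sequence of items with sizes in $(0,1]$ is revealed online. When an item of size $x$ arrives, the algorithm places a primary replica of size $x$ and $f$ standby replicas of size $x/\eta$ each into bins of unit capacity, without information about later items; the $f+1$ replicas are packed concurrently (no bin fails meanwhile), must lie in $f+1$ different bins, and are never moved afterwards. During the process bins may fail and failed bins may recover, with at most $f$ bins failed at any time. In a valid packing a primary replica of every item must always be available in a non-failed bin: upon failure of a bin with a primary replica of an item, a standby replica of it in a non-failed bin must be promoted to primary (its size growing from $x/\eta$ to $x$), without overloading any bin. An algorithm may change the status of replicas from standby to primary and vice versa. **Algorithm Harmonic-Stretch (packing strategy).** *Classes.* An item has primary class $i\in\{1,\dots,5\}$ if its primary replica has size in $(\frac1{i+1},\frac1i]$, class $6$ if in $(\frac1{7-1/\eta},\frac16]$, class $7$ if at most $\frac1{7-1/\eta}$. It has standby class $j\in\{1,\dots,\lfloor 6\eta\rfloor-1\}$ if its standby replicas have size in $(\frac1{j+\eta},\frac1{j+\eta-1}]$, class $\lfloor 6\eta\rfloor$ if in $(\frac1{7\eta-1},\frac1{\lfloor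 6\eta\rfloor+\eta-1}]$, class $\lfloor 6\eta\rfloor+1$ if at most $\frac1{7\eta-1}$. An item of primary class $i$ and standby class $j$ is an $(i,j)$-item. It is small if $i=7$ (equivalently $j=\lfloor 6\eta\rfloor+1$), and regular otherwise. Items of different classes $(i,j)$ never share a bin. *Groups.* For each class $(i,j)$ the algorithm maintains groups of bins, one of which is the active group, into which arriving $(i,j)$-items are packed. A group is incomplete until it becomes complete (see below). A group is available if none of its bins is failed; the active group is always available. When the active group becomes complete or one of its bins fails, a new active group is selected: any incomplete available group if one exists, otherwise a fresh group of empty non-failed bins is opened. *Regular items.* A group for regular $(i,j)$-items has $j$ primary bins $B_0,\dots,B_{j-1}$, each split into $i$ spots of capacity $1/i$, and $fi$ standby bins $\beta^k_z$ ($1\le k\le f$, $0\le z\le i-1$), each split into $j$ spots (labelled $0,\dots,j-1$) of size $\frac1{j+\eta-1}$ (leaving a reserved space of $\frac{\eta-1}{j+\eta-1}$). For the $t$-th item of the group ($0\le t\le ij-1$), with $w=t \bmod j$ and $z=\lfloor t/j\rfloor$, the primary replica goes into spot $z$ of $B_w$ and the standby replicas into spot $w$ of $\beta^1_z,\dots,\beta^f_z$. The group is complete once $ij$ items are placed in it. *Small items.* Consecutive small items are merged into super-replicas (SRs): a primary SR has capacity $\frac2{7-1/\eta}$ and each of its $f$ corresponding standby SRs has capacity $\frac2{7\eta-1}$. A group for small items has $f$ mirroring standby bins (containing the same standby SRs) and one primary bin currently committed to it (which counts as a bin of the group). Primary bins not committed to any group are free. An arriving small item is placed into the currently open SRs of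 the active group: its standby replicas into the open standby SRs in the $f$ mirroring bins, its primary replica into the open primary SR in the committed bin. If it does not fit in the open SRs (capacity would be exceeded), these SRs are closed and new SRs must be opened: if the available space in the mirroring bins of the active group is at least $\frac{2\eta}{7\eta-1}$ (this keeps a reserved space of $\frac{2(\eta-1)}{7\eta-1}$), the $f$ new standby SRs are placed there; otherwise the active group becomes complete, a new active group for small items is selected (any incomplete available group for small items if one exists, otherwise a fresh group of empty non-failed bins is opened), and the item is processed with that group in the same way. To place the new primary SR, the bin committed to the active group is freed (the committed bin of a group that becomes complete is likewise freed), and any free non-failed primary bin $B'$ is selected that has empty space at least $\frac2{7-1/\eta}$ and shares no SR with the $f$ standby bins of the active group; if none exists a new primary bin $B'$ is opened. $B'$ becomes committed to the active group and receives the new primary SR. An SR is treated as a single replica, promoted and demoted as a unit. *)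

(* Defs.v *)
From mathcomp Require Import all_boot all_order all_algebra reals.

Set Implicit Arguments.
Unset Strict Implicit.
Unset Printing Implicit Defensive.

Import Order.TTheory GRing.Theory Num.Theory.
Local Open Scope ring_scope.

Definition nstandby (R : realType) (eta : R) : nat := Num.truncn (6 * eta).

Definition primary_class (R : realType) (eta x : R) (i : nat) : bool :=
  [|| (1 <= i <= 5)%N && (i.+1%:R^-1 < x <= i%:R^-1),
      (i == 6%N) && ((7 - eta^-1)^-1 < x <= 6^-1)
    | (i == 7%N) && (x <= (7 - eta^-1)^-1)].

(* [y] is the size of a standby replica, i.e. the size of the item over [eta]. *)
Definition standby_class (R : realType) (eta y : R) (j : nat) : bool :=
  let m := nstandby eta in
  [|| (1 <= j <= m.-1)%N && ((j%:R + eta)^-1 < y <= (j%:R + eta - 1)^-1),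
      (j == m) && ((7 * eta - 1)^-1 < y <= (m%:R + eta - 1)^-1)
    | (j == m.+1) && (y <= (7 * eta - 1)^-1)].

Definition small_class (c : nat * nat) : bool := c.1 == 7%N.

(* Bins are natural numbers; items, groups and super-replicas (SRs) are
   referred to by their rank of creation.  Replica [ord0] of an item is the one
   placed as primary replica, replicas [lift ord0 k] are those placed as
   standby replicas; replicas never move, only their status changes. *)
Record item (R : realType) (f : nat) := Item {
  it_size : R;
  it_bin : 'I_f.+1 -> nat;
  it_sr : option nat  (* the SR of a small item *)
}.

(* For a regular class [(i, j)], [g_prim] lists the bins B_0, .., B_(j-1) and
   [g_stby k] the bins beta^k_0, .., beta^k_(i-1); spots are not recorded, as a
   spot is determined by the bin and the rank of the item.  For the small class,
   [g_prim] holds the bin currently committed to the group (it is empty once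
   the group is complete) and [g_stby k] the k-th mirroring bin. *)
Record group (f : nat) := Group {
  g_class : nat * nat;
  g_prim : seq nat;
  g_stby : 'I_f -> seq nat;
  g_count : nat;          (* items placed so far; regular groups only *)
  g_open : option nat;    (* currently open SR; small groups only *)
  g_complete : bool
}.

(* An SR stands for its primary SR, which lies in [sr_bin], and its [f] standby
   SRs, which lie in the mirroring bins of [sr_group]. *)
Record sr := SR { sr_group : nat; sr_bin : nat }.

Record state (R : realType) (f : nat) := State {
  st_failed : seq nat;
  st_used : seq nat;      (* bins opened so far *)
  st_smallprim : seq nat; (* primary bins of small items, committed or free *)
  st_items : seq (item R f);
  st_groups : seq (group f);
  st_srs : seq sr;
  st_active : nat * nat -> option nat  (* [None]: no item of the class yet *)
}.

Definition init (R : realType) (f : nat) : state R f :=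
  State [::] [::] [::] [::] [::] [::] (fun=> None).

Definition item0 (R : realType) (f : nat) : item R f :=
  Item 0 (fun=> 0%N) None.

Definition group0 (f : nat) : group f :=
  Group (0, 0)%N [::] (fun=> [::]) 0 None false.

Definition get_item (R : realType) (f : nat) (s : state R f) (t : nat) :=
  nth (item0 R f) (st_items s) t.

Definition get_group (R : realType) (f : nat) (s : state R f) (g : nat) :=
  nth (group0 f) (st_groups s) g.

Definition set_failed (R : realType) (f : nat) (s : state R f) (F : seq nat) :=
  State F (st_used s) (st_smallprim s) (st_items s) (st_groups s) (st_srs s)
        (st_active s).

Definition set_group (R : realType) (f : nat) (s : state R f) (g : nat)
    (G : group f) :=
  State (st_failed s) (st_used s) (st_smallprim s) (st_items s)
        (set_nth (group0 f) (st_groups s) g G) (st_srs s) (st_active s).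

Definition add_item (R : realType) (f : nat) (s : state R f) (it : item R f) :=
  State (st_failed s) (st_used s) (st_smallprim s) (rcons (st_items s) it)
        (st_groups s) (st_srs s) (st_active s).

Definition set_active (R : realType) (f : nat) (s : state R f) (c : nat * nat)
    (g : nat) :=
  State (st_failed s) (st_used s) (st_smallprim s) (st_items s) (st_groups s)
        (st_srs s) (fun c' => if c' == c then Some g else st_active s c').

Definition replica_bins (f : nat) (p : nat) (m : 'I_f -> nat) (k : 'I_f.+1) :=
  if unlift ord0 k is Some k' then m k' else p.

(* [sigma t k]: replica [k] of item [t] currently is a primary replica. *)
Definition status (f : nat) := nat -> 'I_f.+1 -> bool.

Definition placed_status (f : nat) : status f := fun _ k => k == ord0.

Definition load (R : realType) (f : nat) (eta : R) (s : state R f)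
    (sigma : status f) (b : nat) : R :=
  \sum_(t < size (st_items s))
    \sum_(k < f.+1 | it_bin (get_item s t) k == b)
      (if sigma t k then it_size (get_item s t)
       else it_size (get_item s t) / eta).

(* The packing strategy measures space with every replica counted at the size
   with which it was placed, so that the reserved space is never given away and
   the packing does not depend on the adjustments. *)
Definition free_space (R : realType) (f : nat) (eta : R) (s : state R f)
    (b : nat) : R :=
  1 - load eta s (@placed_status f) b.

Definition group_bins (f : nat) (G : group f) : seq nat :=
  g_prim G ++ flatten [seq g_stby G k | k <- enum 'I_f].

Definition available (R : realType) (f : nat) (s : state R f) (G : group f) :=
  all (fun b => b \notin st_failed s) (group_bins G).

Definition selectable (R : realType) (f : nat) (s : state R f) (c : nat * nat)
    (g : nat) : bool :=
  [&& (g < size (st_groups s))%N, g_class (get_group s g) == c,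
      ~~ g_complete (get_group s g) & available s (get_group s g)].

Definition fresh_bin (R : realType) (f : nat) (s : state R f) (b : nat) :=
  (b \notin st_used s) && (b \notin st_failed s).

Definition fresh_group (R : realType) (f : nat) (s : state R f)
    (c : nat * nat) (G : group f) : Prop :=
  [/\ [/\ g_class G = c, g_count G = 0%N, g_open G = None
        & g_complete G = false],
      size (g_prim G) = if small_class c then 1%N else c.2,
      forall k, size (g_stby G k) = if small_class c then 1%N else c.1,
      uniq (group_bins G)
    & all (fresh_bin s) (group_bins G)].

Definition add_group (R : realType) (f : nat) (s : state R f) (G : group f) :=
  State (st_failed s) (group_bins G ++ st_used s)
        (if small_class (g_class G) then g_prim G ++ st_smallprim s
         else st_smallprim s)
        (st_items s) (rcons (st_groups s) G) (st_srs s) (st_active s).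

Inductive select (R : realType) (f : nat) (s : state R f) (c : nat * nat) :
    state R f -> Prop :=
| SelectIncomplete (g : nat) :
    selectable s c g -> select s c (set_active s c g)
| SelectFresh (G : group f) :
    (forall g, ~~ selectable s c g) -> fresh_group s c G ->
    select s c (set_active (add_group s G) c (size (st_groups s))).

(* The first group of a class is opened when its first item arrives. *)
Definition ensure_active (R : realType) (f : nat) (s : state R f)
    (c : nat * nat) (s' : state R f) : Prop :=
  if st_active s c is Some _ then s' = s else select s c s'.

Definition put_regular (R : realType) (f : nat) (s : state R f) (g : nat)
    (x : R) : state R f :=
  let G := get_group s g in
  let: (i, j) := g_class G in
  let t := g_count G in
  let w := (t %% j)%N in
  let z := (t %/ j)%N in
  let bins :=
    replica_bins (nth 0%N (g_prim G) w) (fun k => nth 0%N (g_stby G k) z) in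
  let G' := Group (g_class G) (g_prim G) (g_stby G) t.+1 (g_open G)
                  (t.+1 == i * j)%N in
  add_item (set_group s g G') (Item x bins None).

Definition pack_regular (R : realType) (f : nat) (s : state R f)
    (c : nat * nat) (x : R) (s' : state R f) : Prop :=
  exists2 g, st_active s c = Some g &
    let s1 := put_regular s g x in
    if g_complete (get_group s1 g) then select s1 c s' else s' = s1.

Definition mirror (f : nat) (G : group f) (k : 'I_f) : nat :=
  nth 0%N (g_stby G k) 0.

Definition sr_content (R : realType) (f : nat) (s : state R f) (r : nat) : R :=
  \sum_(it <- st_items s | it_sr it == Some r) it_size it.

Definition fits (R : realType) (f : nat) (eta : R) (s : state R f)
    (G : group f) (x : R) : bool :=
  if g_open G is Some r then
    (sr_content s r + x <= 2 / (7 - eta^-1)) &&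
    (sr_content s r / eta + x / eta <= 2 / (7 * eta - 1))
  else false.

Definition has_room (R : realType) (f : nat) (eta : R) (s : state R f)
    (G : group f) : bool :=
  [forall k : 'I_f, 2 * eta / (7 * eta - 1) <= free_space eta s (mirror G k)].

Definition put_small (R : realType) (f : nat) (s : state R f) (g r : nat)
    (x : R) : state R f :=
  let p := sr_bin (nth (SR 0 0) (st_srs s) r) in
  add_item s (Item x (replica_bins p (mirror (get_group s g))) (Some r)).

(* The open SR of [g] is closed and its committed bin becomes free. *)
Definition release (R : realType) (f : nat) (s : state R f) (g : nat)
    (complete : bool) : state R f :=
  let G := get_group s g in
  set_group s g (Group (g_class G) [::] (g_stby G) (g_count G) None complete).

Definition is_free (R : realType) (f : nat) (s : state R f) (b : nat) : bool :=
  (b \in st_smallprim s) && all (fun G => b \notin g_prim G) (st_groups s).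

Definition usable (R : realType) (f : nat) (eta : R) (s : state R f)
    (g b : nat) : bool :=
  [&& is_free s b, b \notin st_failed s, 2 / (7 - eta^-1) <= free_space eta s b
    & all (fun r => ~~ ((sr_bin r == b) && (sr_group r == g))) (st_srs s)].

Definition open_sr (R : realType) (f : nat) (s : state R f) (g b : nat) :
    state R f :=
  let G := get_group s g in
  let G' := Group (g_class G) [:: b] (g_stby G) (g_count G)
                  (Some (size (st_srs s))) (g_complete G) in
  State (st_failed s)
        (if b \in st_used s then st_used s else b :: st_used s)
        (if b \in st_smallprim s then st_smallprim s else b :: st_smallprim s)
        (st_items s) (set_nth (group0 f) (st_groups s) g G')
        (rcons (st_srs s) (SR g b)) (st_active s).

Inductive pack_small (R : realType) (f : nat) (eta : R) (c : nat * nat)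
    (x : R) : state R f -> state R f -> Prop :=
| PackOpen (s : state R f) (g r : nat) :
    st_active s c = Some g -> g_open (get_group s g) = Some r ->
    fits eta s (get_group s g) x ->
    pack_small eta c x s (put_small s g r x)
| PackNew (s : state R f) (g b : nat) (s1 := release s g false) :
    st_active s c = Some g ->
    ~~ fits eta s (get_group s g) x -> has_room eta s (get_group s g) ->
    usable eta s1 g b \/ (forall b', ~~ usable eta s1 g b') /\ fresh_bin s1 b ->
    pack_small eta c x s (put_small (open_sr s1 g b) g (size (st_srs s)) x)
| PackNext (s : state R f) (g : nat) (s1 s' : state R f) :
    st_active s c = Some g ->
    ~~ fits eta s (get_group s g) x -> ~~ has_room eta s (get_group s g) ->
    select (release s g true) c s1 -> pack_small eta c x s1 s' ->
    pack_small eta c x s s'.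

Inductive event (R : realType) := Arrive of R | Fail of nat | Recover of nat.

Inductive step (R : realType) (f : nat) (eta : R) (s : state R f) :
    event R -> state R f -> Prop :=
| StepRegular (x : R) (i j : nat) (s1 s' : state R f) :
    0 < x <= 1 -> primary_class eta x i -> standby_class eta (x / eta) j ->
    ~~ small_class (i, j) ->
    ensure_active s (i, j) s1 -> pack_regular s1 (i, j) x s' ->
    step eta s (Arrive x) s'
| StepSmall (x : R) (i j : nat) (s1 s' : state R f) :
    0 < x <= 1 -> primary_class eta x i -> standby_class eta (x / eta) j ->
    small_class (i, j) ->
    ensure_active s (i, j) s1 -> pack_small eta (i, j) x s1 s' ->
    step eta s (Arrive x) s'
| StepFailActive (b : nat) (c : nat * nat) (g : nat) (s' : state R f) :
    b \notin st_failed s -> (size (st_failed s) < f)%N ->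
    st_active s c = Some g -> b \in group_bins (get_group s g) ->
    select (set_failed s (b :: st_failed s)) c s' ->
    step eta s (Fail R b) s'
| StepFailOther (b : nat) :
    b \notin st_failed s -> (size (st_failed s) < f)%N ->
    (forall c g, st_active s c = Some g ->
       b \notin group_bins (get_group s g)) ->
    step eta s (Fail R b) (set_failed s (b :: st_failed s))
| StepRecover (b : nat) :
    b \in st_failed s ->
    step eta s (Recover R b) (set_failed s (rem b (st_failed s))).

(* Most recent event first; each event comes with the state it leads to. *)
Definition history (R : realType) (f : nat) := seq (event R * state R f).

(* An adjustment strategy is consulted after each failure and each recovery,
   knowing the past only; on arrivals the new replicas get the status they are
   placed with and nothing else changes. *)
Definition adjustment (R : realType) (f : nat) := history R f -> status f.

Definition next_status (R : realType) (f : nat) (A : adjustment R f)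
    (h : history R f) (s : state R f) (sigma : status f) (e : event R)
    (s' : state R f) : status f :=
  if e is Arrive _ then
    fun t k => if t == size (st_items s) then placed_status t k else sigma t k
  else A ((e, s') :: h).

Inductive run (R : realType) (f : nat) (eta : R) (A : adjustment R f) :
    history R f -> state R f -> status f -> Prop :=
| RunInit : run eta A [::] (init R f) (@placed_status f)
| RunStep (h : history R f) (s : state R f) (sigma : status f) (e : event R)
    (s' : state R f) :
    run eta A h s sigma -> step eta s e s' ->
    run eta A ((e, s') :: h) s' (next_status A h s sigma e s').

Definition valid (R : realType) (f : nat) (eta : R) (s : state R f)
    (sigma : status f) : Prop :=
  [/\ forall t, (t < size (st_items s))%N ->
        exists2 k, sigma t k & it_bin (get_item s t) k \notin st_failed s,
      forall b, load eta s sigma b <= 1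
    & forall t, (t < size (st_items s))%N -> injective (it_bin (get_item s t))].

(* An SR is promoted and demoted as a unit. *)
Definition sr_uniform (R : realType) (f : nat) (s : state R f)
    (sigma : status f) : Prop :=
  forall t t' r, (t < size (st_items s))%N -> (t' < size (st_items s))%N ->
    it_sr (get_item s t) = Some r -> it_sr (get_item s t') = Some r ->
    sigma t =1 sigma t'.

(* Main.v *)
(** Replica 0 of every item stays primary forever. When its bin [p] fails, one
    standby is promoted in addition: the item's standby bins form a row [m] of
    [f] bins, and if [p] is the [n]-th failed bin outside the row, the [n]-th
    non-failed bin of the row gets the promotion. As at most [f] bins are failed,
    the row has enough non-failed bins, and since distinct items (or SRs) sharing
    a row have distinct primary bins, every standby bin carries at most one
    promoted item (or SR), which the reserved space absorbs. This status is a
    function of the current state only, and an arrival does not disturb it: a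
    new item is packed in an available group, so its primary bin is not failed.
    It remains to maintain an invariant of the packing which bounds the loads
    with every replica counted at the size it was placed with. *)

Require Import Defs.
From mathcomp Require Import all_boot all_order all_algebra reals.
From mathcomp Require Import ring lra zify.
Import Order.TTheory GRing.Theory Num.Theory.
Local Open Scope ring_scope.

Set Implicit Arguments.
Unset Strict Implicit.
Unset Printing Implicit Defensive.

(** * Rows of standby bins *)

(** The dealing works because a failed bin inside a row removes one bin from the row but also uses
    up one of the at most [f] failures: the failed bins outside the row never outnumber the
    non-failed bins inside it.

    The obstacle lies with the small items. Their primary bins migrate between groups, so
    disjointness of groups does not separate the SRs of a row. What does is the rule that a primary
    bin receives at most one SR of each group: a pair (group, primary bin) identifies an SR.
    Moreover, space is tested only when an SR is opened, while its items arrive later. The bounds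
    that survive arrivals therefore charge an open SR at full capacity, and an arrival merely
    converts charged slack into load.

    For regular items the constants are tight: with [D = j + eta - 1], the [j] standby spots of a
    bin take [j / D] and a single promotion adds at most [(eta - 1) / D], which sum to 1. *)

Section Bins.
Variable f : nat.
Implicit Types (G : group f) (m : 'I_f -> nat).

Lemma mem_group_bins G b :
  (b \in group_bins G) = (b \in g_prim G) || [exists k, b \in g_stby G k].
Proof.
rewrite mem_cat; congr (_ || _); apply/flatten_mapP/existsP.
  by case=> k _ bk; exists k.
by case=> k bk; exists k; rewrite ?mem_enum.
Qed.

Lemma prim_group_bins G b : b \in g_prim G -> b \in group_bins G.
Proof. by rewrite mem_group_bins => ->. Qed.

Lemma stby_group_bins G k b : b \in g_stby G k -> b \in group_bins G.
Proof.
by move=> bk; rewrite mem_group_bins; apply/orP; right; apply/existsP; exists k.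
Qed.

Lemma uniq_prim G : uniq (group_bins G) -> uniq (g_prim G).
Proof. by rewrite cat_uniq; case/and3P. Qed.

Lemma prim_notin_stby G k b :
  uniq (group_bins G) -> b \in g_prim G -> b \in g_stby G k -> False.
Proof.
rewrite cat_uniq => /and3P[_ /hasPn dis _] bp bk.
have /dis /= : b \in flatten [seq g_stby G i | i <- enum 'I_f].
  by apply/flatten_mapP; exists k; rewrite ?mem_enum.
by rewrite bp.
Qed.

Lemma uniq_flatten_map (T S : eqType) (F : T -> seq S) (e : seq T) :
  uniq (flatten [seq F i | i <- e]) ->
  (forall k, k \in e -> uniq (F k)) /\
  (uniq e -> forall k k' b, k \in e -> k' \in e ->
     b \in F k -> b \in F k' -> k = k').
Proof.
elim: e => [//|a e IH] /=; rewrite cat_uniq => /and3P[ua /hasPn dis /IH[IH1 IH2]].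
split=> [k|/andP[_ ue] k k' b]; rewrite !inE.
  by case/orP=> [/eqP->//|/IH1].
have out c : c \in F a -> forall l, l \in e -> c \in F l -> False.
  move=> ca l le cl; suff /dis : c \in flatten [seq F i | i <- e] by rewrite /= ca.
  by apply/flatten_mapP; exists l.
case/orP=> [/eqP->|ke] /orP[/eqP->|k'e] //.
- by move=> bk bk'; case: (out _ bk _ k'e bk').
- by move=> bk bk'; case: (out _ bk' _ ke bk).
- exact: IH2.
Qed.

Lemma uniq_stby G k : uniq (group_bins G) -> uniq (g_stby G k).
Proof.
rewrite cat_uniq => /and3P[_ _ /uniq_flatten_map[u _]].
by apply: u; rewrite mem_enum.
Qed.

Lemma stby_inj G k k' b : uniq (group_bins G) ->
  b \in g_stby G k -> b \in g_stby G k' -> k = k'.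
Proof.
rewrite cat_uniq => /and3P[_ _ /uniq_flatten_map[_ u]].
by apply: u; rewrite ?enum_uniq ?mem_enum.
Qed.

Definition live (F : seq nat) m := [seq k <- enum 'I_f | m k \notin F].
Definition outside (F : seq nat) m := [seq b <- F | b \notin codom m].

(** The default of [nth] is [k] itself, as ['I_f] has no canonical element. An index out of range
    would thus promote every [k]; [promoted_index] excludes this for uniq [F] of size at most [f]
    and an injective row avoiding [p]. *)
Definition promoted (F : seq nat) m (p : nat) (k : 'I_f) : bool :=
  (p \in F) && (k == nth k (live F m) (index p (outside F m))).

Lemma eq_promoted (F : seq nat) m m' p : m =1 m' ->
  promoted F m p =1 promoted F m' p.
Proof.
move=> e k; rewrite /promoted /live /outside.
by rewrite (eq_codom e) (eq_filter (a2 := fun k => m' k \notin F)) // => l; rewrite e.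
Qed.

(** [F] splits into bins outside and inside the row, and the [f] positions of the row into live and
    failed ones. By injectivity the failed positions are at most as many as the bins of [F] inside
    the row; subtract from [size F <= f]. *)
Lemma size_outside_live (F : seq nat) m :
  uniq F -> (size F <= f)%N -> injective m ->
  (size (outside F m) <= size (live F m))%N.
Proof.
move=> uF sF mI.
have e1 : (size (outside F m) + count [in codom m] F = size F)%N.
  by rewrite size_filter addnC count_predC.
have e2 : (size (live F m) + count (fun k => m k \in F) (enum 'I_f) = f)%N.
  by rewrite size_filter addnC (count_predC (fun k => m k \in F)) size_enum_ord.
suff : (count (fun k => m k \in F) (enum 'I_f) <= count [in codom m] F)%N by lia.
rewrite -(count_map m (fun b => b \in F)) -!size_filter.
apply: uniq_leq_size.
  by rewrite filter_uniq // map_inj_uniq // enum_uniq.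
by move=> b; rewrite !mem_filter codomE => /andP[-> ->].
Qed.

Lemma promoted_index (F : seq nat) m p :
  uniq F -> (size F <= f)%N -> injective m -> p \in F -> p \notin codom m ->
  (index p (outside F m) < size (live F m))%N.
Proof.
move=> uF sF mI pF pm; apply: leq_trans (size_outside_live uF sF mI).
by rewrite index_mem mem_filter pm.
Qed.

Lemma promoted_exists (F : seq nat) m p :
  uniq F -> (size F <= f)%N -> injective m -> p \in F -> p \notin codom m ->
  exists2 k, promoted F m p k & m k \notin F.
Proof.
move=> uF sF mI pF pm; have lt := promoted_index uF sF mI pF pm.
(* The bound [lt] forces [live F m] to be nonempty, which supplies a default element for [nth]. *)
have [k0 _] : exists k0, k0 \in live F m.
  by case: (live F m) lt => // k l _; exists k; rewrite mem_head.
exists (nth k0 (live F m) (index p (outside F m))).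
  by rewrite /promoted pF (set_nth_default k0) ?eqxx.
by have := mem_nth k0 lt; rewrite mem_filter => /andP[].
Qed.

Lemma promoted_inj (F : seq nat) m p p' k :
  uniq F -> (size F <= f)%N -> injective m -> p \notin codom m ->
  p' \notin codom m -> promoted F m p k -> promoted F m p' k -> p = p'.
Proof.
move=> uF sF mI pm pm' /andP[pF /eqP e] /andP[pF' /eqP e'].
have u : uniq (live F m) by rewrite filter_uniq ?enum_uniq.
have lt := promoted_index uF sF mI pF pm.
have lt' := promoted_index uF sF mI pF' pm'.
have /eqP := etrans (esym e) e'; rewrite nth_uniq // => /eqP ei.
have inF b : b \in F -> b \notin codom m -> b \in outside F m.
  by move=> bF bm; rewrite mem_filter bm.
by rewrite -[p](nth_index 0%N (inF _ pF pm)) ei nth_index ?inF.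
Qed.

End Bins.
(** * Loads *)

Section Loads.
Variables (R : realType) (f : nat) (eta : R).
Implicit Types (s : state R f) (m : 'I_f -> nat).

Definition stbys (it : item R f) (k : 'I_f) : nat := it_bin it (lift ord0 k).

Definition canon s : status f := fun t k =>
  if unlift ord0 k is Some k' then
    promoted (st_failed s) (stbys (get_item s t)) (it_bin (get_item s t) ord0) k'
  else true.

(* The items whose primary replica lies in [p] and [k]-th standby in [b] form
   the unit (a single regular item, or an SR) promoted together in [b]. *)
Definition unit_content s (p : nat) (k : 'I_f) (b : nat) : R :=
  \sum_(t < size (st_items s) | (it_bin (get_item s t) ord0 == p)
                                && (stbys (get_item s t) k == b))
    it_size (get_item s t).

Notation placed_load s b := (load eta s (@placed_status f) b).

Lemma replica_bins0 p m : replica_bins p m ord0 = p.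
Proof. by rewrite /replica_bins unlift_none. Qed.

Lemma replica_bins_lift p m k : replica_bins p m (lift ord0 k) = m k.
Proof. by rewrite /replica_bins liftK. Qed.

Lemma replica_bins_inj p m :
  injective m -> p \notin codom m -> injective (replica_bins p m).
Proof.
move=> mI pm k l; case: (unliftP ord0 k) => [k'|] ->; case: (unliftP ord0 l) => [l'|] ->;
  rewrite ?replica_bins0 ?replica_bins_lift //.
- by move/mI->.
- by move=> e; rewrite -e codom_f in pm.
- by move=> e; rewrite e codom_f in pm.
Qed.

Lemma sum_replicas (P : pred 'I_f.+1) (F : 'I_f.+1 -> R) :
  \sum_(k | P k) F k =
  (if P ord0 then F ord0 else 0) + \sum_(k | P (lift ord0 k)) F (lift ord0 k).
Proof. by rewrite big_mkcond big_ord_recl -big_mkcond. Qed.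

Lemma get_item_add s it t :
  get_item (add_item s it) t =
  if t == size (st_items s) then it else get_item s t.
Proof.
rewrite /get_item nth_rcons; case: ltngtP => // lt.
by rewrite nth_default // ltnW.
Qed.

Lemma load_add s it (sigma : status f) b :
  load eta (add_item s it) sigma b = load eta s sigma b +
  \sum_(k | it_bin it k == b)
     (if sigma (size (st_items s)) k then it_size it else it_size it / eta).
Proof.
rewrite /load /= size_rcons big_ord_recr /= get_item_add eqxx; congr (_ + _).
by apply: eq_bigr => t _; rewrite get_item_add ltn_eqF.
Qed.

Lemma placed_load_add s x p m o b :
  placed_load (add_item s (Item x (replica_bins p m) o)) b = placed_load s b +
  ((if p == b then x else 0) + \sum_(k | m k == b) x / eta).
Proof.
rewrite load_add /= sum_replicas /= replica_bins0; congr (_ + (_ + _)).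
by apply: eq_big => k; rewrite ?replica_bins_lift.
Qed.

Lemma placed_load_add_prim s x p m o : p \notin codom m ->
  placed_load (add_item s (Item x (replica_bins p m) o)) p = placed_load s p + x.
Proof.
move=> pm; rewrite placed_load_add eqxx big_pred0 ?addr0 // => k.
by apply/eqP => e; rewrite -e codom_f in pm.
Qed.

Lemma placed_load_add_stby s x p m o k : injective m -> p \notin codom m ->
  placed_load (add_item s (Item x (replica_bins p m) o)) (m k) =
  placed_load s (m k) + x / eta.
Proof.
move=> mI pm; rewrite placed_load_add ifF ?add0r; last first.
  by apply/eqP => e; rewrite e codom_f in pm.
by rewrite (big_pred1 k) // => l; rewrite /= (inj_eq mI).
Qed.

Lemma placed_load_add_other s x p m o b : p != b -> b \notin codom m ->
  placed_load (add_item s (Item x (replica_bins p m) o)) b = placed_load s b.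
Proof.
move=> /negPf pb bm; rewrite placed_load_add pb big_pred0 ?addr0 // => k.
by apply/eqP => e; rewrite -e codom_f in bm.
Qed.

Lemma unit_content_add s x p m o p' k b :
  unit_content (add_item s (Item x (replica_bins p m) o)) p' k b =
  unit_content s p' k b + (if (p == p') && (m k == b) then x else 0).
Proof.
rewrite /unit_content /= size_rcons big_mkcond big_ord_recr /= get_item_add eqxx.
rewrite /stbys /= replica_bins0 replica_bins_lift; congr (_ + _).
rewrite [RHS]big_mkcond; apply: eq_bigr => t _.
by rewrite get_item_add (ltn_eqF (ltn_ord t)).
Qed.

Lemma sr_content_add s it r :
  sr_content (add_item s it) r =
  sr_content s r + (if it_sr it == Some r then it_size it else 0).
Proof. by rewrite /sr_content big_rcons. Qed.

(** All items promoted in [b] sit there at the same standby position and have the same row, by the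
    last hypothesis. By [promoted_inj] they then share their primary bin, so they all belong to one
    unit, and only that unit can grow in [b]. *)
Lemma load_canon s b : 1 < eta ->
  uniq (st_failed s) -> (size (st_failed s) <= f)%N ->
  (forall t, (t < size (st_items s))%N -> 0 <= it_size (get_item s t)) ->
  (forall t, (t < size (st_items s))%N -> injective (it_bin (get_item s t))) ->
  (forall t t' k k', (t < size (st_items s))%N -> (t' < size (st_items s))%N ->
     stbys (get_item s t) k = stbys (get_item s t') k' ->
     k = k' /\ stbys (get_item s t) =1 stbys (get_item s t')) ->
  load eta s (canon s) b <= placed_load s b \/
  exists t k, [/\ (t < size (st_items s))%N, stbys (get_item s t) k = b &
    load eta s (canon s) b <= placed_load s b +
      (1 - eta^-1) * unit_content s (it_bin (get_item s t) ord0) k b].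
Proof.
move=> e1 uF sF szp inj row.
have e0 : 0 < eta by apply: lt_trans e1.
have ei : eta^-1 < 1 by rewrite invf_lt1.
pose prom (t : nat) k :=
  promoted (st_failed s) (stbys (get_item s t)) (it_bin (get_item s t) ord0) k.
(* Promotion turns [x / eta] into [x], a growth of [(1 - eta^-1) * x]. *)
have eq_load : load eta s (canon s) b = placed_load s b +
    (1 - eta^-1) * \sum_(t < size (st_items s))
      \sum_(k | (stbys (get_item s t) k == b) && prom t k)
         it_size (get_item s t).
  rewrite mulr_sumr -big_split /=; apply: eq_bigr => t _.
  rewrite !sum_replicas /canon /= unlift_none -addrA; congr (_ + _).
  rewrite big_mkcondr mulr_sumr -big_split /=; apply: eq_bigr => k _.
  rewrite liftK -/(prom t k); case: (prom t k); last by rewrite mulr0 addr0.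
  by field; rewrite gt_eqF.
have stI t : (t < size (st_items s))%N -> injective (stbys (get_item s t)).
  by move=> lt k l /(inj _ lt) /lift_inj.
have pst t : (t < size (st_items s))%N ->
    it_bin (get_item s t) ord0 \notin codom (stbys (get_item s t)).
  move=> lt; apply/codomP => -[k /(inj _ lt) /eqP].
  by rewrite (negPf (neq_lift _ _)).
case: (pickP (fun tk : 'I_(size (st_items s)) * 'I_f =>
   (stbys (get_item s tk.1) tk.2 == b) && prom tk.1 tk.2)) => [[t1 k1]|none].
  move=> /andP[/= /eqP b1 pr1]; right; exists t1, k1; split=> //.
  rewrite eq_load lerD2l; apply: ler_wpM2l; first by rewrite subr_ge0 ltW.
  (* The comparison is made item by item: a promoted item lies in the unit of [t1] and counts once
     on both sides, and the other items contribute nothing on the left. *)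
  rewrite /unit_content [leRHS]big_mkcond /=; apply: ler_sum => t _.
  case: (pickP (fun k => (stbys (get_item s t) k == b) && prom t k)) => [k|no].
    move=> /andP[/eqP bk prk].
    have [ek er] : k = k1 /\ stbys (get_item s t) =1 stbys (get_item s t1).
      by apply: row => //; rewrite bk.
    rewrite ek in bk prk *.
    have ep : it_bin (get_item s t) ord0 = it_bin (get_item s t1) ord0.
      apply: (promoted_inj uF sF (stI _ (ltn_ord t1)) _ _ _ pr1) => //.
      - by rewrite -(eq_codom er) pst.
      - exact: pst.
      - by rewrite -(eq_promoted _ _ er).
    rewrite ep bk !eqxx (big_pred1 k1) // => l.
    rewrite [RHS]/=; apply/andP/eqP => [[/eqP bl _]|->]; last by rewrite bk eqxx.
    by apply: (stI t) => //; rewrite bl bk.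
  by rewrite big_pred0 //; case: ifP => // _; apply: szp.
left; rewrite eq_load big1 ?mulr0 ?addr0 // => t _; rewrite big_pred0 // => k.
by have := none (t, k).
Qed.

End Loads.

(** * Counting the ranks of a group that fall in one bin *)

Lemma count_iotaS (P : pred nat) n :
  count P (iota 0 n.+1) = (count P (iota 0 n) + P n)%N.
Proof. by rewrite -addn1 iotaD count_cat /= addn0. Qed.

Lemma count_divn_eq j z n : (0 < j)%N ->
  (count (fun q => q %/ j == z)%N (iota 0 n) <= j)%N.
Proof.
move=> j0; rewrite -size_filter -[leqRHS](size_iota (z * j) j).
apply: uniq_leq_size; first by rewrite filter_uniq // iota_uniq.
move=> q; rewrite mem_filter !mem_iota => /andP[/eqP <- _].
by rewrite leq_divM addnC -mulSn ltn_ceil.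
Qed.

Lemma count_modn_eq i j w n : (0 < j)%N -> (n <= i * j)%N ->
  (count (fun q => q %% j == w)%N (iota 0 n) <= i)%N.
Proof.
move=> j0 ni; rewrite -size_filter -[leqRHS](size_iota 0 i).
rewrite -[leqRHS](size_map (fun k => k * j + w)%N).
apply: uniq_leq_size; first by rewrite filter_uniq // iota_uniq.
move=> q; rewrite mem_filter !mem_iota => /andP[/eqP <- /= qn].
apply/mapP; exists (q %/ j)%N; last by rewrite -divn_eq.
by rewrite mem_iota /= add0n ltn_divLR // (leq_trans qn).
Qed.

(** * Invariant of the packing *)

Section Invariant.
Variables (R : realType) (f : nat) (eta : R).
Implicit Types (s : state R f) (G : group f) (m : 'I_f -> nat).

Notation placed_load s b := (load eta s (@placed_status f) b).
Notation sr_at s r := (nth (SR 0 0) (st_srs s) r).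

(* Capacity of a primary SR; that of a standby SR is [cap / eta], the space
   required in the mirroring bins to open an SR is again [cap], and the space
   they keep reserved is [(1 - eta^-1) * cap]. *)
Definition cap : R := 2 / (7 - eta^-1).

Definition is_small G := small_class (g_class G).

(** A regular item does not record its group or its rank, so both are existential here;
    [q < g_count G] says that the spot has already been filled. This ties the bins of an item to the
    current groups and SRs, although they were fixed on arrival. *)
Variant item_ok s (it : item R f) : Prop :=
| SmallItem (r : nat) of it_sr it = Some r & (r < size (st_srs s))%N
    & it_bin it =1 replica_bins (sr_bin (sr_at s r))
                     (mirror (get_group s (sr_group (sr_at s r))))
| RegularItem (g q : nat) (G := get_group s g) of it_sr it = None
    & ~~ is_small G & (q < g_count G)%N
    & it_bin it =1 replica_bins (nth 0 (g_prim G) (q %% (g_class G).2))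
                     (fun k => nth 0 (g_stby G k) (q %/ (g_class G).2)).

(* Most fields range over all [g]: out of range, [get_group] returns the empty
   [group0]. In [wf_sp_open] and [wf_mirror_open] the open SR of [g] is counted
   at its full capacity. *)
Record wf s : Prop := Wf {
  wf_uniq g : uniq (group_bins (get_group s g));
  wf_used g b : b \in group_bins (get_group s g) -> b \in st_used s;
  wf_disj g g' b : b \in group_bins (get_group s g) ->
    b \in group_bins (get_group s g') -> g = g';
  wf_stby g k : size (g_stby (get_group s g) k) =
    if is_small (get_group s g) then 1 else (g_class (get_group s g)).1;
  wf_prim g : ~~ is_small (get_group s g) ->
    size (g_prim (get_group s g)) = (g_class (get_group s g)).2;
  wf_sp_used b : b \in st_smallprim s -> b \in st_used s;
  wf_sp_prim g b : is_small (get_group s g) ->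
    b \in g_prim (get_group s g) -> b \in st_smallprim s;
  wf_sp_reg g b : ~~ is_small (get_group s g) ->
    b \in g_prim (get_group s g) -> b \notin st_smallprim s;
  wf_sp_stby g k b : b \in g_stby (get_group s g) k -> b \notin st_smallprim s;
  wf_count g : let G := get_group s g in
    (g_count G <= (g_class G).1 * (g_class G).2)%N;
  wf_incomplete g : let G := get_group s g in (g < size (st_groups s))%N ->
    ~~ is_small G -> ~~ g_complete G ->
    (g_count G < (g_class G).1 * (g_class G).2)%N;
  wf_open g r : g_open (get_group s g) = Some r ->
    [/\ is_small (get_group s g), (r < size (st_srs s))%N,
        sr_group (sr_at s r) = g
      & g_prim (get_group s g) = [:: sr_bin (sr_at s r)]];
  wf_sr r : (r < size (st_srs s))%N ->
    is_small (get_group s (sr_group (sr_at s r))) /\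
    sr_bin (sr_at s r) \in st_smallprim s;
  wf_sr_inj r r' : (r < size (st_srs s))%N -> (r' < size (st_srs s))%N ->
    sr_group (sr_at s r) = sr_group (sr_at s r') ->
    sr_bin (sr_at s r) = sr_bin (sr_at s r') -> r = r';
  wf_item t : (t < size (st_items s))%N -> item_ok s (get_item s t);
  wf_size t : (t < size (st_items s))%N -> 0 <= it_size (get_item s t);
  wf_reg_prim g w : let G := get_group s g in
    ~~ is_small G -> (w < (g_class G).2)%N ->
    placed_load s (nth 0%N (g_prim G) w) <=
    (count (fun q => q %% (g_class G).2 == w)%N (iota 0 (g_count G)))%:R
      / (g_class G).1%:R;
  wf_reg_stby g k z : let G := get_group s g in
    ~~ is_small G -> (z < (g_class G).1)%N ->
    placed_load s (nth 0%N (g_stby G k) z) <=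
    (count (fun q => q %/ (g_class G).2 == z)%N (iota 0 (g_count G)))%:R
      / ((g_class G).2%:R + eta - 1);
  wf_unit g q k : let G := get_group s g in
    ~~ is_small G -> (q < (g_class G).1 * (g_class G).2)%N ->
    unit_content s (nth 0%N (g_prim G) (q %% (g_class G).2)) k
                   (nth 0%N (g_stby G k) (q %/ (g_class G).2)) <=
    if (q < g_count G)%N then eta / ((g_class G).2%:R + eta - 1) else 0;
  wf_content r : sr_content s r <= cap;
  wf_sp_load b : b \in st_smallprim s -> placed_load s b <= 1;
  wf_sp_open g r : g_open (get_group s g) = Some r ->
    placed_load s (sr_bin (sr_at s r)) + cap - sr_content s r <= 1;
  wf_mirror g k : is_small (get_group s g) ->
    placed_load s (mirror (get_group s g) k) + (1 - eta^-1) * cap <= 1;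
  wf_mirror_open g k r : g_open (get_group s g) = Some r ->
    placed_load s (mirror (get_group s g) k) + (cap - sr_content s r) / eta
      + (1 - eta^-1) * cap <= 1
}.

Lemma cap_gt0 : 1 < eta -> 0 < cap.
Proof.
move=> e1; have e0 : 0 < eta by apply: lt_trans e1.
have : eta^-1 < 1 by rewrite invf_lt1.
by move=> ?; rewrite divr_gt0 //; lra.
Qed.

Lemma cap_le1 : 1 < eta -> cap <= 1.
Proof.
move=> e1; have e0 : 0 < eta by apply: lt_trans e1.
have : eta^-1 < 1 by rewrite invf_lt1.
by move=> ?; rewrite /cap ler_pdivrMr; lra.
Qed.

Lemma cap_stby : 1 < eta -> 2 * eta / (7 * eta - 1) = cap.
Proof.
move=> e1; have e0 : 0 < eta by apply: lt_trans e1.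
by rewrite /cap; field; rewrite !gt_eqF //; lra.
Qed.

Lemma get_group_default s g : (size (st_groups s) <= g)%N ->
  get_group s g = group0 f.
Proof. exact: nth_default. Qed.

Lemma get_group_set s g G g' :
  get_group (set_group s g G) g' = if g' == g then G else get_group s g'.
Proof. by rewrite /get_group nth_set_nth. Qed.

Lemma get_group_add s G g :
  get_group (add_group s G) g =
  if g == size (st_groups s) then G else get_group s g.
Proof.
rewrite /get_group nth_rcons; case: ltngtP => // lt.
by rewrite nth_default // ltnW.
Qed.

Lemma size_set_group s g G : (g < size (st_groups s))%N ->
  size (st_groups (set_group s g G)) = size (st_groups s).
Proof. by move=> lt; rewrite size_set_nth; apply/maxn_idPr. Qed.

Lemma wf_init : 1 < eta -> wf (init R f).
Proof.
move=> e1; have gE g : get_group (init R f) g = group0 f.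
  by rewrite get_group_default.
have lE b : placed_load (init R f) b = 0 by rewrite /load big_ord0.
have cE r : sr_content (init R f) r = 0 by rewrite /sr_content big_nil.
have c0 := cap_gt0 e1.
have memF g b : (b \in group_bins (get_group (init R f) g)) = false.
  by rewrite mem_group_bins gE; apply/existsP => -[].
constructor=> //=.
- move=> g; rewrite gE /group_bins /=.
  by elim: (enum 'I_f) => //= a l; rewrite cat_uniq.
- by move=> g b; rewrite memF.
- by move=> g g' b; rewrite memF.
- by move=> g k; rewrite gE.
- by move=> g; rewrite gE.
- by move=> g b; rewrite gE.
- by move=> g; rewrite gE.
- by move=> g r; rewrite gE.
- by move=> g w; rewrite gE.
- by move=> g k z; rewrite gE.
- by move=> g q k; rewrite gE.
- by move=> r; rewrite cE ltW.
- by move=> g r; rewrite gE.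
- by move=> g k; rewrite gE.
- by move=> g k r; rewrite gE.
Qed.

(** * The bins of a single item under the invariant *)

Lemma row_inj s g z : wf s ->
  (forall k, (z < size (g_stby (get_group s g) k))%N) ->
  injective (fun k => nth 0%N (g_stby (get_group s g) k) z).
Proof.
move=> W lt k l e; apply: (stby_inj (wf_uniq W g) (mem_nth 0%N (lt k))).
by rewrite e mem_nth.
Qed.

(** The two alternatives are the two kinds of primary bins. The bin of a closed SR may belong to no
    group, so disjointness of groups says nothing about it, and membership in [st_smallprim] is used
    instead. A regular primary bin lies in the group of the row at worst, where primary and standby
    bins differ. *)
Lemma row_disj s g z b : wf s ->
  (forall k, (z < size (g_stby (get_group s g) k))%N) ->
  b \in st_smallprim s \/ (exists g', b \in g_prim (get_group s g')) ->
  b \notin codom (fun k => nth 0%N (g_stby (get_group s g) k) z).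
Proof.
move=> W lt hb; apply/codomP => -[k e].
have bk : b \in g_stby (get_group s g) k by rewrite e mem_nth.
case: hb => [|[g' bg']]; first by rewrite (negPf (wf_sp_stby W bk)).
have eg := wf_disj W (prim_group_bins bg') (stby_group_bins bk).
by rewrite eg in bg'; apply: (prim_notin_stby (wf_uniq W g) bg' bk).
Qed.

(** Unifies the two kinds of items: the mirroring bins are row 0 of a small group. Its first half is
    the hypothesis of [row_disj]. *)
Lemma item_row s t : wf s -> (t < size (st_items s))%N ->
  (it_bin (get_item s t) ord0 \in st_smallprim s \/
   exists g', it_bin (get_item s t) ord0 \in g_prim (get_group s g')) /\
  exists g z, (forall k, (z < size (g_stby (get_group s g) k))%N) /\
    stbys (get_item s t) =1 (fun k => nth 0%N (g_stby (get_group s g) k) z).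
Proof.
move=> W lt; case: (wf_item W lt) => [r _ rlt e|g q G _ ns qlt e].
  have [sm sp] := wf_sr W rlt; split; first by left; rewrite e replica_bins0.
  exists (sr_group (sr_at s r)), 0%N; split.
    by move=> k; rewrite (wf_stby W) sm.
  by move=> k; rewrite /stbys e replica_bins_lift.
have qij := leq_trans qlt (wf_count W g).
have j0 : (0 < (g_class G).2)%N by move: qij; rewrite -/G; case: (_.2) => //; rewrite muln0.
split.
  right; exists g; rewrite e replica_bins0 mem_nth //.
  by rewrite (wf_prim W ns) ltn_mod.
exists g, (q %/ (g_class G).2)%N; split.
  by move=> k; rewrite (wf_stby W) (negPf ns) ltn_divLR.
by move=> k; rewrite /stbys e replica_bins_lift.
Qed.

Lemma item_bin_used s t k : wf s -> (t < size (st_items s))%N ->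
  it_bin (get_item s t) k \in st_used s.
Proof.
move=> W lt; have [hp [g [z [zlt e]]]] := item_row W lt.
case: (unliftP ord0 k) => [k'|] ->.
  rewrite -/(stbys _ _) e; apply: (wf_used W (g := g)).
  by apply: (@stby_group_bins _ _ k'); rewrite mem_nth.
case: hp => [|[g' h]]; first exact: wf_sp_used.
exact: (wf_used W (prim_group_bins h)).
Qed.

Lemma placed_load0 s b :
  (forall t k, (t < size (st_items s))%N -> it_bin (get_item s t) k != b) ->
  placed_load s b = 0.
Proof.
move=> no; rewrite /load big1 // => t _; rewrite big_pred0 // => k.
exact/negbTE/no.
Qed.

Lemma unit_content0 s p k b :
  (forall t, (t < size (st_items s))%N -> it_bin (get_item s t) ord0 != p) ->
  unit_content s p k b = 0.
Proof.
move=> no; rewrite /unit_content big_pred0 // => t.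
by rewrite (negPf (no _ (ltn_ord t))).
Qed.

Lemma placed_load_unused s b : wf s -> b \notin st_used s -> placed_load s b = 0.
Proof.
move=> W bu; apply: placed_load0 => t k lt; apply/eqP => e.
by rewrite -e item_bin_used in bu.
Qed.

(** Operations append SRs, keep standby bins and only increase counts. The range condition for
    regular groups is there because a fresh group replaces the default [group0] at the first free
    index; that default is not small and has count 0, so no item refers to it. *)
Lemma item_ok_mono s s' it : wf s -> item_ok s it ->
  (forall r, (r < size (st_srs s))%N ->
     (r < size (st_srs s'))%N /\ sr_at s' r = sr_at s r) ->
  (forall g, is_small (get_group s g) ->
     g_stby (get_group s' g) = g_stby (get_group s g)) ->
  (forall g, ~~ is_small (get_group s g) -> (g < size (st_groups s))%N ->
     [/\ g_class (get_group s' g) = g_class (get_group s g),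
         g_prim (get_group s' g) = g_prim (get_group s g),
         g_stby (get_group s' g) = g_stby (get_group s g)
       & (g_count (get_group s g) <= g_count (get_group s' g))%N]) ->
  item_ok s' it.
Proof.
move=> W; case=> [r er rlt e|g q G er ns qlt e] hr hs hg.
  have [rlt' e'] := hr _ rlt; have [sm _] := wf_sr W rlt.
  apply: (SmallItem er rlt') => k; rewrite e e'; congr replica_bins.
  by rewrite /mirror hs.
have glt : (g < size (st_groups s))%N.
  by rewrite ltnNge; apply/negP => /get_group_default G0; rewrite /G G0 in qlt.
have [ec ep es ecnt] := hg _ ns glt.
apply: (@RegularItem s' it g q) => //; rewrite ?/is_small ?ec //.
  exact: leq_trans ecnt.
by move=> k; rewrite e ep es.
Qed.

(** * Preservation of the invariant by the elementary operations *)

Lemma wf_set_active s c g : wf s -> wf (set_active s c g).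
Proof.
move=> W; case: (W) => *; constructor=> // t lt.
exact: item_ok_mono W (wf_item W lt) _ _ _.
Qed.

Lemma wf_set_failed s F : wf s -> wf (set_failed s F).
Proof.
move=> W; case: (W) => *; constructor=> // t lt.
exact: item_ok_mono W (wf_item W lt) _ _ _.
Qed.

Lemma unit_content_unused s p k b : wf s -> p \notin st_used s ->
  unit_content s p k b = 0.
Proof.
move=> W pu; apply: unit_content0 => t lt; apply/eqP => e.
by rewrite -e item_bin_used in pu.
Qed.

Lemma wf_sr_group s r : wf s -> (r < size (st_srs s))%N ->
  (sr_group (sr_at s r) < size (st_groups s))%N.
Proof.
move=> W /(wf_sr W)[sm _]; rewrite ltnNge; apply/negP => /get_group_default e.
by rewrite e in sm.
Qed.

Lemma wf_add_group s c G : 1 < eta -> wf s -> fresh_group s c G ->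
  (~~ small_class c -> (0 < c.1)%N && (0 < c.2)%N) -> wf (add_group s G).
Proof.
move=> e1 W [[ec ecnt eo ecmp] szp szs uG /allP fr] cpos.
have e0 : 0 < eta by apply: lt_trans e1.
have ei : eta^-1 < 1 by rewrite invf_lt1.
have ei0 : 0 < eta^-1 by rewrite invr_gt0.
have c0 := cap_gt0 e1; have c1 := cap_le1 e1.
have frU b : b \in group_bins G -> b \in st_used s -> False.
  by move=> /fr /andP[/negP].
have frU' b : b \in group_bins G -> b \notin st_used s by move=> /fr /andP[].
have smG : is_small G = small_class c by rewrite /is_small ec.
have pl0 b : b \in group_bins G -> placed_load s b = 0.
  by move=> /frU'; apply: placed_load_unused.
have primG w : ~~ is_small G -> (w < c.2)%N -> nth 0%N (g_prim G) w \in group_bins G.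
  move=> ns lt; apply/prim_group_bins/mem_nth.
  by rewrite szp -smG (negPf ns).
have stbyG k z : ~~ is_small G -> (z < c.1)%N -> nth 0%N (g_stby G k) z \in group_bins G.
  move=> ns lt; apply/(@stby_group_bins _ _ k)/mem_nth.
  by rewrite szs -smG (negPf ns).
have srNE r : (r < size (st_srs s))%N -> (sr_group (sr_at s r) == size (st_groups s)) = false.
  by move/(wf_sr_group W)/ltn_eqF.
have usedE b : (b \in st_used (add_group s G)) =
    (b \in group_bins G) || (b \in st_used s) by rewrite -mem_cat.
constructor; cbv zeta.
- move=> g; rewrite get_group_add; case: eqP => // _; exact: (wf_uniq W g).
- move=> g b; rewrite get_group_add usedE.
  by case: eqP => _ => [->//|/(wf_used W) ->]; exact: orbT.
- move=> g g' b; rewrite !get_group_add; do 2 case: eqP => [->|_] //.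
  + by move=> /frU h /(wf_used W).
  + by move=> /(wf_used W) h /frU.
  + exact: (wf_disj W).
- move=> g k; rewrite get_group_add; case: eqP => _; last exact: (wf_stby W g k).
  by rewrite szs smG ec.
- move=> g; rewrite get_group_add; case: eqP => _; last exact: (wf_prim W).
  by rewrite smG szp ec => /negPf->.
- move=> b bs; have : b \in group_bins G \/ b \in st_smallprim s.
    move: bs => /=; case: ifP => _; last by right.
    by rewrite mem_cat => /orP[/prim_group_bins|]; [left|right].
  rewrite usedE => -[->//|/(wf_sp_used W) ->]; exact: orbT.
- move=> g b; rewrite get_group_add /=; case: eqP => _.
    by rewrite /is_small => -> h; rewrite mem_cat h.
  move=> sm h; have := wf_sp_prim W sm h.
  by case: ifP => // _; rewrite mem_cat => ->; rewrite orbT.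
- move=> g b; rewrite get_group_add /=; case: eqP => _.
    rewrite /is_small => /negPf-> /prim_group_bins h; apply/negP.
    by move/(wf_sp_used W); apply: frU.
  move=> ns h; have hs := wf_sp_reg W ns h.
  case: ifP => // _; rewrite mem_cat negb_or hs andbT; apply/negP.
  move=> /prim_group_bins /frU; apply; exact: (wf_used W (prim_group_bins h)).
- move=> g k b; rewrite get_group_add /=; case: eqP => _ h.
    have hs : b \notin st_smallprim s.
      by apply/negP => /(wf_sp_used W); apply: frU; apply: stby_group_bins h.
    case: ifP => // _; rewrite mem_cat negb_or hs andbT; apply/negP => h'.
    exact: (prim_notin_stby uG h' h).
  have hs := wf_sp_stby W h.
  case: ifP => // _; rewrite mem_cat negb_or hs andbT; apply/negP.
  move=> /prim_group_bins /frU; apply; exact: (wf_used W (stby_group_bins h)).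
- move=> g; rewrite get_group_add; case: eqP => _; last exact: (wf_count W g).
  by rewrite ecnt.
- move=> g; rewrite get_group_add size_rcons ltnS; case: eqP => [_ _|/eqP ne].
    by rewrite ecnt ec smG => /cpos /andP[? ?] _; rewrite muln_gt0; apply/andP.
  by rewrite leq_eqVlt (negPf ne) => /(wf_incomplete W).
- move=> g r; rewrite get_group_add /=; case: eqP => _; first by rewrite eo.
  exact: (wf_open W).
- move=> r rlt; rewrite get_group_add /= srNE //; have [sm sp] := wf_sr W rlt.
  by split=> //; case: ifP => // _; rewrite mem_cat sp orbT.
- exact: (wf_sr_inj W).
- move=> t lt; apply: item_ok_mono W (wf_item W lt) _ _ _ => // g.
    move=> sm; rewrite get_group_add; case: eqP => // eg.
    by rewrite eg get_group_default in sm.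
  by move=> _ lt'; rewrite get_group_add ltn_eqF.
- exact: (wf_size W).
- move=> g w; rewrite get_group_add; case: eqP => _ ns lt; last exact: (wf_reg_prim W ns lt).
  by rewrite [X in X <= _]pl0 ?ecnt ?mul0r // primG // -ec.
- move=> g k z; rewrite get_group_add; case: eqP => _ ns lt; last exact: (wf_reg_stby W k ns lt).
  by rewrite [X in X <= _]pl0 ?ecnt ?mul0r // stbyG // -ec.
- move=> g q k; rewrite get_group_add; case: eqP => _ ns lt; last exact: (wf_unit W k ns lt).
  have j0 : (0 < (g_class G).2)%N.
    by case: (g_class G).2 lt; rewrite ?muln0.
  rewrite ecnt ltn0 [X in X <= _](unit_content_unused _ _ W) //; apply: frU'.
  by apply: primG => //; rewrite -ec ltn_mod.
- exact: (wf_content W).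
- move=> b bs; have : b \in group_bins G \/ b \in st_smallprim s.
    move: bs => /=; case: ifP => _; last by right.
    by rewrite mem_cat => /orP[/prim_group_bins|]; [left|right].
  case=> [h|]; last exact: (wf_sp_load W).
  by rewrite [X in X <= _]pl0.
- move=> g r; rewrite get_group_add; case: eqP => _; first by rewrite eo.
  exact: (wf_sp_open W).
- move=> g k; rewrite get_group_add; case: eqP => _ sm; last exact: (wf_mirror W k sm).
  rewrite [X in X + _]pl0 ?add0r; last first.
    by apply: (@stby_group_bins _ _ k); rewrite mem_nth // szs -smG sm.
  by have := mulr_gt0 ei0 c0; lra.
- move=> g k r; rewrite get_group_add; case: eqP => _; first by rewrite eo.
  exact: (wf_mirror_open W).
Qed.

(** The freed bin leaves the group but stays in [st_smallprim], which keeps its load bound and its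
    separation from standby bins. The other obligations about the group only become weaker. *)
Lemma wf_release s g cmp : wf s -> (g < size (st_groups s))%N ->
  is_small (get_group s g) -> wf (release s g cmp).
Proof.
move=> W glt smg; rewrite /release; set G' := Defs.Group _ _ _ _ _ _.
have sub b g' : b \in group_bins (get_group (set_group s g G') g') ->
    b \in group_bins (get_group s g').
  rewrite get_group_set; case: eqP => [->|//]; rewrite !mem_group_bins /=.
  by move->; rewrite orbT.
have gE g' : [/\ g_class (get_group (set_group s g G') g') = g_class (get_group s g'),
    g_stby (get_group (set_group s g G') g') = g_stby (get_group s g'),
    g_count (get_group (set_group s g G') g') = g_count (get_group s g') &
    (forall b, b \in g_prim (get_group (set_group s g G') g') -> b \in g_prim (get_group s g'))].
  by rewrite get_group_set; case: eqP => // ->.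
have gR g' : ~~ is_small (get_group (set_group s g G') g') ->
    get_group (set_group s g G') g' = get_group s g'.
  by rewrite get_group_set; case: eqP => [_|//]; rewrite (smg : is_small G').
have gO g' r : g_open (get_group (set_group s g G') g') = Some r ->
    get_group (set_group s g G') g' = get_group s g'.
  by rewrite get_group_set; case: eqP.
have smE g' : is_small (get_group (set_group s g G') g') = is_small (get_group s g').
  by rewrite /is_small; case: (gE g') => ->.
constructor; cbv zeta.
- move=> g'; rewrite get_group_set; case: eqP => [_|_]; last exact: (wf_uniq W g').
  by have := wf_uniq W g; rewrite cat_uniq => /and3P[].
- by move=> g' b /sub /(wf_used W).
- by move=> g' g'' b /sub h /sub; apply: (wf_disj W h).
- by move=> g' k; rewrite smE; case: (gE g') => -> -> _ _; apply: (wf_stby W g' k).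
- by move=> g' ns; rewrite (gR _ ns); apply: (wf_prim W); rewrite -smE.
- exact: (wf_sp_used W).
- by move=> g' b; rewrite smE; case: (gE g') => _ _ _ h sm /h; apply: (wf_sp_prim W sm).
- by move=> g' b; rewrite smE; case: (gE g') => _ _ _ h sm /h; apply: (wf_sp_reg W sm).
- by move=> g' k b; case: (gE g') => _ -> _ _; apply: (wf_sp_stby W).
- by move=> g'; case: (gE g') => -> _ -> _; apply: (wf_count W g').
- move=> g'; rewrite size_set_group // => lt ns; rewrite (gR _ ns).
  by apply: (wf_incomplete W lt); rewrite -smE.
- by move=> g' r h; move: (h); rewrite (gO _ _ h); apply: (wf_open W).
- by move=> r /(wf_sr W); rewrite smE.
- exact: (wf_sr_inj W).
- move=> t lt; apply: item_ok_mono W (wf_item W lt) _ _ _ => // g'.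
    by case: (gE g').
  by move=> ns _; rewrite gR ?smE.
- exact: (wf_size W).
- move=> g' w ns; rewrite (gR _ ns); rewrite smE in ns; exact: (wf_reg_prim W ns).
- move=> g' k z ns; rewrite (gR _ ns); rewrite smE in ns; exact: (wf_reg_stby W k ns).
- move=> g' q k ns; rewrite (gR _ ns); rewrite smE in ns; exact: (wf_unit W k ns).
- exact: (wf_content W).
- exact: (wf_sp_load W).
- by move=> g' r h; move: (h); rewrite (gO _ _ h); apply: (wf_sp_open W).
- move=> g' k; rewrite smE /mirror; case: (gE g') => _ -> _ _; exact: (wf_mirror W k).
- by move=> g' k r h; move: (h); rewrite (gO _ _ h); apply: (wf_mirror_open W).
Qed.
Lemma sr_content_new s r : wf s -> (size (st_srs s) <= r)%N ->
  sr_content s r = 0.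
Proof.
move=> W le; rewrite /sr_content (big_nth (item0 R f)) big_mkord big_pred0 // => t.
rewrite -/(get_item s t); case: (wf_item W (ltn_ord t)) => [r' -> lt _|g q _ -> //].
by apply/eqP => -[e]; rewrite e ltnNge le in lt.
Qed.

(** The hypotheses abstract what a free usable bin and a fresh bin have in common. The one on
    existing SRs preserves [wf_sr_inj]; the last two pay in advance for the full capacity of the new
    SR. *)
Lemma wf_open_sr s g b : 1 < eta -> wf s -> (g < size (st_groups s))%N ->
  is_small (get_group s g) ->
  (forall g', b \notin group_bins (get_group s g')) ->
  (forall r, (r < size (st_srs s))%N -> sr_bin (sr_at s r) = b ->
     sr_group (sr_at s r) <> g) ->
  placed_load s b + cap <= 1 ->
  (forall k, placed_load s (mirror (get_group s g) k) + cap <= 1) ->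
  wf (open_sr s g b).
Proof.
move=> e1 W glt smg bG bsr bload mload.
have e0 : 0 < eta by apply: lt_trans e1.
have c0 := cap_gt0 e1.
set s' := open_sr s g b; set r0 := size (st_srs s).
pose G' := Defs.Group (g_class (get_group s g)) [:: b] (g_stby (get_group s g))
  (g_count (get_group s g)) (Some r0) (g_complete (get_group s g)).
have gE g' : get_group s' g' = if g' == g then G' else get_group s g'.
  exact: get_group_set.
have srE r : sr_at s' r = if r == r0 then SR g b else sr_at s r.
  rewrite nth_rcons -/r0; case: ltngtP => // lt.
  by rewrite nth_default // ltnW.
have srsE : size (st_srs s') = r0.+1 by rewrite size_rcons.
have usedE c : (c \in st_used s') = (c == b) || (c \in st_used s).
  rewrite /=; case: ifP => [bu|_]; last by rewrite inE.
  by case: eqP => // ->; rewrite bu.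
have spE c : (c \in st_smallprim s') = (c == b) || (c \in st_smallprim s).
  rewrite /=; case: ifP => [bu|_]; last by rewrite inE.
  by case: eqP => // ->; rewrite bu.
have smE g' : is_small (get_group s' g') = is_small (get_group s g').
  by rewrite gE; case: eqP => // ->.
have stE g' : g_stby (get_group s' g') = g_stby (get_group s g').
  by rewrite gE; case: eqP => // ->.
have clE g' : g_class (get_group s' g') = g_class (get_group s g').
  by rewrite gE; case: eqP => // ->.
have gR g' : ~~ is_small (get_group s g') -> get_group s' g' = get_group s g'.
  by rewrite gE; case: eqP => // ->; rewrite smg.
have memE g' c : c \in group_bins (get_group s' g') ->
    (c = b /\ g' = g) \/ (c <> b /\ c \in group_bins (get_group s g')).
  rewrite gE => h; case: (eqVneq c b) => [e|/eqP cb]; last first.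
    right; split=> //; move: h; case: eqP => // ->.
    rewrite !mem_group_bins /= inE => /orP[/eqP//|->]; exact: orbT.
  rewrite e in h *; left; split=> //; move: h; case: eqP => // _ h.
  by have := bG g'; rewrite h.
have oE g' r : g_open (get_group s' g') = Some r ->
    (g' = g /\ r = r0) \/
    [/\ get_group s' g' = get_group s g' & g_open (get_group s g') = Some r].
  by rewrite gE; case: eqP => [->|_] h; [left; case: h|right].
constructor; cbv zeta.
- move=> g'; rewrite gE; case: eqP => [_|_]; last exact: (wf_uniq W g').
  have := wf_uniq W g; rewrite cat_uniq => /and3P[_ _ u].
  rewrite /group_bins /= u andbT.
  by have := bG g; rewrite mem_cat negb_or => /andP[].
- move=> g' c /memE[[-> _]|[_ /(wf_used W) h]]; rewrite usedE ?eqxx //.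
  by rewrite h orbT.
- move=> g' g'' c /memE[[-> ->]|[cb h]] /memE[[e' ->]|[cb' h']] //.
  exact: (wf_disj W h h').
- by move=> g' k; rewrite smE stE clE; apply: (wf_stby W g' k).
- by move=> g'; rewrite smE => ns; rewrite gR //; apply: (wf_prim W).
- by move=> c; rewrite spE usedE => /orP[->//|/(wf_sp_used W) ->]; exact: orbT.
- move=> g' c; rewrite smE spE gE; case: eqP => [_ _|_ sm /(wf_sp_prim W sm) ->].
    by rewrite inE => ->.
  exact: orbT.
- move=> g' c; rewrite smE => ns; rewrite gR // => h.
  rewrite spE negb_or (wf_sp_reg W ns h) andbT; apply/eqP => e.
  by have := bG g'; rewrite -e prim_group_bins.
- move=> g' k c; rewrite stE => h; rewrite spE negb_or (wf_sp_stby W h) andbT.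
  by apply/eqP => e; have := bG g'; rewrite -e (stby_group_bins h).
- move=> g'; rewrite clE gE; case: eqP => [->|_]; last exact: (wf_count W g').
  exact: (wf_count W g).
- move=> g'; rewrite size_set_group // smE => lt ns; rewrite gR //.
  exact: (wf_incomplete W).
- move=> g' r h; rewrite smE srE srsE; case: (oE _ _ h) => [[-> ->]|[-> h']].
    by rewrite eqxx gE eqxx; split.
  have [? lt ? ?] := wf_open W h'; rewrite (ltn_eqF lt).
  by split=> //; apply: ltnW.
- move=> r; rewrite srsE ltnS leq_eqVlt srE smE spE.
  case: eqP => [_ _|_ /= /(wf_sr W)[-> ->]]; first by rewrite eqxx.
  by rewrite orbT.
- move=> r r'; rewrite srsE !ltnS leq_eqVlt (leq_eqVlt r') !srE.
  case: eqP => [->|_]; case: eqP => [->|_] //= lt lt'.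
  + by move=> e e'; case: (bsr _ lt').
  + by move=> e e'; case: (bsr _ lt).
  + exact: (wf_sr_inj W).
- move=> t lt; apply: item_ok_mono W (wf_item W lt) _ _ _ => [r rlt|g' _|g' ns _].
  + by rewrite srsE srE (ltn_eqF rlt); split=> //; apply: ltnW.
  + exact: stE.
  + by rewrite gR.
- exact: (wf_size W).
- by move=> g' w; rewrite smE => ns; rewrite gR //; apply: (wf_reg_prim W).
- by move=> g' k z; rewrite smE => ns; rewrite gR //; apply: (wf_reg_stby W k).
- by move=> g' q k; rewrite smE => ns; rewrite gR //; apply: (wf_unit W k).
- exact: (wf_content W).
- move=> c; rewrite spE => /orP[/eqP->|]; last exact: (wf_sp_load W).
  by apply: le_trans bload; rewrite lerDl ltW.
- move=> g' r /oE[[_ ->]|[_ h]].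
    by rewrite srE eqxx [sr_content _ _](sr_content_new W) ?subr0.
  by have [_ lt _ _] := wf_open W h; rewrite srE (ltn_eqF lt); apply: (wf_sp_open W h).
- by move=> g' k; rewrite smE /mirror stE; apply: (wf_mirror W k).
- move=> g' k r; rewrite /mirror stE => /oE[[-> ->]|[_ h]]; last exact: (wf_mirror_open W k h).
  rewrite [sr_content _ _](sr_content_new W) // subr0.
  (* The room [cap] splits into [cap / eta] for the standby SR, still empty, and
     [(1 - eta^-1) * cap] kept in reserve. *)
  by apply: le_trans (mload k); rewrite -addrA lerD2l mulrBl mul1r mulrC; lra.
Qed.

(** The load of the committed bin grows by [x] while the uncharged part of the open SR shrinks by
    [x], so the bound of [wf_sp_open] is unchanged; the mirroring bins behave alike with
    [x / eta]. *)
Lemma wf_put_small s g r x : 1 < eta -> wf s ->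
  g_open (get_group s g) = Some r -> 0 <= x -> sr_content s r + x <= cap ->
  wf (put_small s g r x).
Proof.
move=> e1 W og x0 fit.
have e0 : 0 < eta by apply: lt_trans e1.
have [smg rlt rg rp] := wf_open W og.
rewrite /put_small; set p := sr_bin _; set m := mirror _; set s' := add_item _ _.
have zlt k : (0 < size (g_stby (get_group s g) k))%N by rewrite (wf_stby W) smg.
have mI : injective m := row_inj W zlt.
have psp : p \in st_smallprim s by case: (wf_sr W rlt).
have pm : p \notin codom m by apply: (row_disj W zlt); left.
have mst k : m k \in g_stby (get_group s g) k by rewrite mem_nth.
have pg : p \in g_prim (get_group s g) by rewrite rp mem_head.
have mg g' b : b \in group_bins (get_group s g') -> b \in codom m -> g' = g.
  move=> h /codomP[k e]; rewrite e in h.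
  exact: (wf_disj W h (stby_group_bins (mst k))).
have spm b : b \in st_smallprim s -> b \notin codom m.
  by move=> bs; apply: (row_disj W zlt); left.
have plp : placed_load s' p = placed_load s p + x by apply: placed_load_add_prim.
have plm k : placed_load s' (m k) = placed_load s (m k) + x / eta.
  exact: placed_load_add_stby.
have plo b : p != b -> b \notin codom m -> placed_load s' b = placed_load s b.
  exact: placed_load_add_other.
have scE r' : sr_content s' r' = sr_content s r' + (if r == r' then x else 0).
  by rewrite /s' sr_content_add.
(* The committed bin [p] lies in no other group, so [r] is the only open SR whose primary bin is
   [p]. *)
have oI g' r' : g_open (get_group s g') = Some r' ->
    sr_bin (sr_at s r') = p \/ g' = g -> g' = g /\ r' = r.
  move=> h hp; have [_ _ _ rp'] := wf_open W h.
  have eg : g' = g.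
    case: hp => // e; apply: (@wf_disj _ W _ _ p); apply: prim_group_bins => //.
    by rewrite rp' e mem_head.
  by split=> //; move: h; rewrite eg og => -[].
have ier : 0 <= eta^-1 by rewrite invr_ge0 ltW.
(* The slack left in the standby SR, in the product form that [lra] can combine linearly with
   [wf_mirror_open]. *)
have fit' : 0 <= (cap - sr_content s r - x) * eta^-1.
  by rewrite mulr_ge0 //; lra.
have plR g' b : ~~ is_small (get_group s g') ->
    b \in group_bins (get_group s g') -> b \notin st_smallprim s ->
    placed_load s' b = placed_load s b.
  move=> ns h bs; apply: plo; first by apply: contraNneq bs => <-.
  by apply/negP => /(mg _ _ h) e; rewrite e smg in ns.
have primR g' w : ~~ is_small (get_group s g') -> (w < (g_class (get_group s g')).2)%N ->
    nth 0%N (g_prim (get_group s g')) w \in g_prim (get_group s g').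
  by move=> ns lt; rewrite mem_nth // (wf_prim W ns).
(* The fields closed at once speak of groups, bins and SRs only, which the arrival leaves alone. *)
constructor; cbv zeta; try by case: (W).
- move=> t; rewrite /= size_rcons ltnS leq_eqVlt get_item_add.
  have mono it : item_ok s it -> item_ok s' it.
    by move=> ok; apply: (item_ok_mono W ok).
  case: eqP => [_ _|_ /= /(wf_item W)/mono //].
  by apply: (@SmallItem s' _ r) => //= k; rewrite rg.
- move=> t; rewrite /= size_rcons ltnS leq_eqVlt get_item_add.
  by case: eqP => [//|_ /= /(wf_size W)].
- move=> g' w ns lt; have h := primR _ _ ns lt.
  rewrite [X in X <= _](plR g') //; last exact: (wf_sp_reg W ns h).
    exact: (wf_reg_prim W).
  exact: prim_group_bins.
- move=> g' k z ns lt.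
  have h : nth 0%N (g_stby (get_group s g') k) z \in g_stby (get_group s g') k.
    by rewrite mem_nth // (wf_stby W) (negPf ns).
  rewrite [X in X <= _](plR g') //; last exact: (wf_sp_stby W h).
    exact: (wf_reg_stby W).
  exact: (stby_group_bins h).
- move=> g' q k ns lt; rewrite unit_content_add.
  rewrite ifF ?addr0; first exact: (wf_unit W).
  have j0 : (0 < (g_class (get_group s g')).2)%N.
    by case: (g_class _).2 lt; rewrite ?muln0.
  have h := primR g' (q %% (g_class (get_group s g')).2)%N ns.
  rewrite ltn_mod j0 in h; have := wf_sp_reg W ns (h isT).
  by apply: contraNF => /andP[/eqP <-].
- move=> r'; rewrite scE; case: eqP => [<-//|_]; rewrite addr0.
  exact: (wf_content W).
- move=> b bs; case: (eqVneq p b) => [<-|pb].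
    by rewrite plp; have := wf_sp_open W og; rewrite -/p => ?; lra.
  rewrite plo //; [exact: (wf_sp_load W)|exact: spm].
- move=> g' r' h; case: (eqVneq (sr_bin (sr_at s r')) p) => [e|ne].
    have [eg er] := oI _ _ h (or_introl e).
    rewrite er plp scE eqxx; have := wf_sp_open W og; rewrite -/p => ?; lra.
  rewrite scE ifF; last by apply: contraNF ne => /eqP <-.
  rewrite addr0 [X in X + _ - _]plo; first exact: (wf_sp_open W h).
    by rewrite eq_sym.
  by apply: spm; have [_ lt _ _] := wf_open W h; case: (wf_sr W lt).
- move=> g' k sm; case: (eqVneq g' g) => [->|ne].
    by rewrite -/(m k) plm; have := wf_mirror_open W k og; rewrite -/(m k); lra.
  have h : mirror (get_group s g') k \in g_stby (get_group s g') k.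
    by rewrite mem_nth // (wf_stby W) sm.
  rewrite [X in X + _]plo; first exact: (wf_mirror W).
    by apply: contraNneq (wf_sp_stby W h) => <-.
  by apply: contra ne => /(mg _ _ (stby_group_bins h)) ->.
- move=> g' k r' o'; case: (eqVneq g' g) => [e|ne].
    have [_ ->] := oI _ _ o' (or_intror e).
    rewrite e -/(m k) plm scE eqxx; have := wf_mirror_open W k og; rewrite -/(m k).
    by lra.
  have [sm lt rg' _] := wf_open W o'.
  rewrite scE ifF; last first.
    by apply: contraNF ne => /eqP er; rewrite -rg' -er rg.
  have h : mirror (get_group s g') k \in g_stby (get_group s g') k.
    by rewrite mem_nth // (wf_stby W) sm.
  rewrite addr0 [X in X + _ + _]plo; first exact: (wf_mirror_open W k o').
    by apply: contraNneq (wf_sp_stby W h) => <-.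
  by apply: contra ne => /(mg _ _ (stby_group_bins h)) ->.
Qed.
Lemma put_regularE s g x (G := get_group s g) (t := g_count G)
    (c := g_class G) :
  put_regular s g x =
  add_item (set_group s g (Defs.Group c (g_prim G) (g_stby G) t.+1 (g_open G)
                             (t.+1 == c.1 * c.2)%N))
    (Item x (replica_bins (nth 0%N (g_prim G) (t %% c.2))
               (fun k => nth 0%N (g_stby G k) (t %/ c.2))) None).
Proof. by rewrite /put_regular {}/c -/G; case: (g_class G). Qed.

(** The item of rank [t] raises the counts of primary bin [t %% j] and of row [t %/ j] by one, and
    its size bounds allow exactly one more spot in each. Since (remainder, quotient) determines the
    rank, its unit was empty before. *)
Lemma wf_put_regular s g x : 1 < eta -> wf s -> (g < size (st_groups s))%N ->
  ~~ is_small (get_group s g) -> ~~ g_complete (get_group s g) -> 0 <= x ->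
  x <= (g_class (get_group s g)).1%:R^-1 ->
  x / eta <= ((g_class (get_group s g)).2%:R + eta - 1)^-1 ->
  wf (put_regular s g x).
Proof.
move=> e1 W glt ns ninc x0 xp xs.
have e0 : 0 < eta by apply: lt_trans e1.
have tlt := wf_incomplete W glt ns ninc.
rewrite put_regularE; move: tlt xp xs.
set G := get_group s g; set t := g_count G; set c := g_class G => tlt xp xs.
set G' := Defs.Group _ _ _ _ _ _; set p := nth 0%N _ _.
set m := fun k : 'I_f => _; set s1 := set_group _ _ _; set s' := add_item _ _.
have j0 : (0 < c.2)%N by case: c.2 tlt; rewrite ?muln0.
have zlt k : (t %/ c.2 < size (g_stby G k))%N.
  by rewrite (wf_stby W) (negPf ns) ltn_divLR.
have mI : injective m := row_inj W zlt.
have pg : p \in g_prim G by rewrite mem_nth // (wf_prim W ns) ltn_mod.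
have pm : p \notin codom m by apply: (row_disj W zlt); right; exists g.
have mst k : m k \in g_stby G k by rewrite mem_nth.
have gE g' : get_group s' g' = if g' == g then G' else get_group s g'.
  exact: get_group_set.
have smE g' : is_small (get_group s' g') = is_small (get_group s g').
  by rewrite gE; case: eqP => // ->.
have stE g' : g_stby (get_group s' g') = g_stby (get_group s g').
  by rewrite gE; case: eqP => // ->.
have prE g' : g_prim (get_group s' g') = g_prim (get_group s g').
  by rewrite gE; case: eqP => // ->.
have clE g' : g_class (get_group s' g') = g_class (get_group s g').
  by rewrite gE; case: eqP => // ->.
have opE g' : g_open (get_group s' g') = g_open (get_group s g').
  by rewrite gE; case: eqP => // ->.
have gbE g' : group_bins (get_group s' g') = group_bins (get_group s g').
  by rewrite /group_bins prE stE.
have cntE g' : g_count (get_group s' g') =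
    if g' == g then t.+1 else g_count (get_group s g').
  by rewrite gE; case: eqP.
have plp : placed_load s' p = placed_load s p + x by apply: placed_load_add_prim.
have plm k : placed_load s' (m k) = placed_load s (m k) + x / eta.
  exact: placed_load_add_stby.
have plo b : p != b -> b \notin codom m -> placed_load s' b = placed_load s b.
  exact: placed_load_add_other.
have plG g' b : g' != g -> b \in group_bins (get_group s g') ->
    placed_load s' b = placed_load s b.
  move=> ne h; apply: plo.
    by apply: contraNneq ne => e; rewrite -e in h; rewrite (wf_disj W h (prim_group_bins pg)).
  apply: contra ne => /codomP[k e]; rewrite e in h.
  by rewrite (wf_disj W h (stby_group_bins (mst k))).
have plS b : b \in st_smallprim s -> placed_load s' b = placed_load s b.
  move=> bs; apply: plo; last by apply: (row_disj W zlt); left.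
  by apply: contraTneq bs => <-; apply: (wf_sp_reg W ns).
have scE r : sr_content s' r = sr_content s r.
  by rewrite /s' sr_content_add /= addr0.
have primR g' w : ~~ is_small (get_group s g') -> (w < (g_class (get_group s g')).2)%N ->
    nth 0%N (g_prim (get_group s g')) w \in g_prim (get_group s g').
  by move=> ns' lt; rewrite mem_nth // (wf_prim W ns').
have stbyR g' k z : ~~ is_small (get_group s g') -> (z < (g_class (get_group s g')).1)%N ->
    nth 0%N (g_stby (get_group s g') k) z \in g_stby (get_group s g') k.
  by move=> ns' lt; rewrite mem_nth // (wf_stby W) (negPf ns').
have mirR g' k : is_small (get_group s g') ->
    placed_load s' (mirror (get_group s g') k) = placed_load s (mirror (get_group s g') k).
  move=> sm; apply: (plG g'); first by apply: contraNneq ns => <-.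
  by apply: (@stby_group_bins _ _ k); rewrite mem_nth // (wf_stby W) sm.
have uP := uniq_prim (wf_uniq W g).
have uS k := uniq_stby k (wf_uniq W g).
have szP : size (g_prim G) = c.2 := wf_prim W ns.
have szS k : size (g_stby G k) = c.1 by rewrite (wf_stby W) (negPf ns).
constructor; cbv zeta.
- by move=> g'; rewrite gbE; apply: (wf_uniq W).
- by move=> g' b; rewrite gbE; apply: (wf_used W).
- by move=> g' g'' b; rewrite !gbE; apply: (wf_disj W).
- by move=> g' k; rewrite smE stE clE; apply: (wf_stby W).
- by move=> g'; rewrite smE prE clE; apply: (wf_prim W).
- exact: (wf_sp_used W).
- by move=> g' b; rewrite smE prE; apply: (wf_sp_prim W).
- by move=> g' b; rewrite smE prE; apply: (wf_sp_reg W).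
- by move=> g' k b; rewrite stE; apply: (wf_sp_stby W).
- move=> g'; rewrite clE cntE; case: eqP => [->//|_]; exact: (wf_count W g').
- move=> g'; rewrite smE clE cntE /= -/s1 size_set_group // gE.
  case: eqP => [->|_]; last exact: (wf_incomplete W).
  by rewrite /= -/G -/c => _ _ ne; rewrite ltn_neqAle ne.
- by move=> g' r; rewrite opE smE prE; apply: (wf_open W).
- by move=> r; rewrite smE; apply: (wf_sr W).
- exact: (wf_sr_inj W).
- move=> u; rewrite /= size_rcons ltnS leq_eqVlt get_item_add.
  case: eqP => [_ _|_ /= /(wf_item W) ok].
    by apply: (@RegularItem s' _ g t); rewrite ?smE ?cntE ?eqxx ?ltnS // => k;
      rewrite clE prE stE.
  apply: (item_ok_mono W ok) => // g'.
  by rewrite clE prE stE cntE => _ _; split=> //; case: eqP => // ->; apply: leqnSn.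
- move=> u; rewrite /= size_rcons ltnS leq_eqVlt get_item_add.
  by case: eqP => [//|_ /= /(wf_size W)].
- move=> g' w; rewrite smE clE prE cntE => ns' lt.
  have h := primR _ _ ns' lt.
  case: (eqVneq g' g) => [e|ne]; last first.
    by rewrite (plG g') //; [exact: (wf_reg_prim W)|exact: prim_group_bins].
  rewrite e -/G -/c in h lt *; have old := wf_reg_prim W ns lt.
  (* The new rank adds 1 to the count precisely when its remainder is [w], that is, when the load of
     this bin changes. *)
  rewrite count_iotaS natrD mulrDl.
  case: (eqVneq (t %% c.2)%N w) => [ew|new].
    have ep : p = nth 0%N (g_prim G) w by rewrite /p ew.
    by rewrite -ep plp mul1r lerD // ep.
  rewrite mul0r addr0 plo //.
    by rewrite /p nth_uniq ?szP ?ltn_mod.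
  by apply: (row_disj W zlt); right; exists g.
- move=> g' k z; rewrite smE clE stE cntE => ns' lt.
  have h := stbyR _ k _ ns' lt.
  case: (eqVneq g' g) => [e|ne]; last first.
    by rewrite (plG g') //; [exact: (wf_reg_stby W)|exact: (stby_group_bins h)].
  rewrite e -/G -/c in h lt *; have old := wf_reg_stby W k ns lt.
  rewrite count_iotaS natrD mulrDl.
  case: (eqVneq (t %/ c.2)%N z) => [ez|nez].
    have em : m k = nth 0%N (g_stby G k) z by rewrite /m ez.
    by rewrite -em plm mul1r lerD // em.
  rewrite mul0r addr0 plo //.
    by apply/eqP => e'; rewrite -e' in h; exact: (prim_notin_stby (wf_uniq W g) pg h).
  apply/codomP => -[l e']; rewrite e' in h.
  have kl := stby_inj (wf_uniq W g) h (mst l).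
  move: e' => /eqP; rewrite -kl /m nth_uniq ?szS // 1?eq_sym ?(negPf nez) //.
  by rewrite ltn_divLR.
- move=> g' q k; rewrite smE clE stE prE cntE => ns' lt.
  rewrite unit_content_add.
  have j0' : (0 < (g_class (get_group s g')).2)%N.
    by case: (g_class _).2 lt; rewrite ?muln0.
  have h : nth 0%N (g_prim (get_group s g')) (q %% (g_class (get_group s g')).2)
      \in g_prim (get_group s g') by rewrite primR // ltn_mod.
  case: (eqVneq g' g) => [e|ne]; last first.
    rewrite ifF ?addr0; first exact: (wf_unit W).
    apply: contraNF ne => /andP[/eqP e _]; rewrite -e in h.
    by rewrite (wf_disj W (prim_group_bins h) (prim_group_bins pg)).
  rewrite e -/G -/c in h lt j0' *; have old := wf_unit W k ns lt.
  rewrite -/G -/c -/t in old.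
  case: (eqVneq q t) => [eq|nq].
    (* At rank [t] the old bound is 0, because [t] was not yet below the count. The unit now
       contains just [x = eta * (x / eta)]. *)
    rewrite eq -/p -/(m k) !eqxx /= ltnSn; rewrite eq ltnn -/p in old.
    rewrite -[leRHS]add0r lerD //.
    have -> : x = eta * (x / eta) by rewrite mulrC divfK // gt_eqF.
    by rewrite ler_pM2l.
  rewrite ltnS leq_eqVlt (negPf nq) /= ifF ?addr0 //.
  apply: contraNF nq; rewrite /p /m !nth_uniq ?szP ?szS ?ltn_mod ?ltn_divLR //.
  by move=> /andP[/eqP em /eqP ed]; rewrite (divn_eq q c.2) (divn_eq t c.2) em ed.
- by move=> r; rewrite scE; apply: (wf_content W).
- by move=> b bs; rewrite plS //; apply: (wf_sp_load W).
- move=> g' r; rewrite opE => o; rewrite scE plS; first exact: (wf_sp_open W o).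
  by have [_ lt _ _] := wf_open W o; case: (wf_sr W lt).
- move=> g' k; rewrite smE => sm; have := wf_mirror W k sm.
  by rewrite -mirR // /mirror stE.
- move=> g' k r; rewrite opE => o; have := wf_mirror_open W k o.
  by have [sm _ _ _] := wf_open W o; rewrite -mirR // /mirror stE scE.
Qed.

(** * Load bounds and validity drawn from the invariant *)

Lemma stby_bound s t k : 1 < eta -> wf s -> (t < size (st_items s))%N ->
  placed_load s (stbys (get_item s t) k) +
  (1 - eta^-1) * unit_content s (it_bin (get_item s t) ord0) k
                              (stbys (get_item s t) k) <= 1.
Proof.
move=> e1 W tlt; have e0 : 0 < eta by apply: lt_trans e1.
have ei : 0 <= 1 - eta^-1 by rewrite subr_ge0 invf_le1 // ltW.
case: (wf_item W tlt) => [r er rlt e|g q G er ns qlt e].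
  have [sm sp] := wf_sr W rlt.
  set g := sr_group (sr_at s r) in e sm.
  have eb : stbys (get_item s t) k = mirror (get_group s g) k.
    by rewrite /stbys e replica_bins_lift.
  rewrite e replica_bins0 eb; apply: le_trans (wf_mirror W k sm).
  rewrite lerD2l ler_wpM2l //; apply: le_trans (wf_content W r).
  rewrite /sr_content (big_nth (item0 R f)) big_mkord /unit_content.
  rewrite big_mkcond [leRHS]big_mkcond; apply: ler_sum => u _ /=.
  rewrite -/(get_item s u); case: ifP => [/andP[/eqP up /eqP us]|_]; last first.
    by case: ifP => // _; apply: (wf_size W).
  (* Every item of the unit belongs to the SR [r]: the shared mirroring bin fixes the group, and
     then the shared primary bin fixes the SR by [wf_sr_inj]. A regular item is excluded, as its
     primary bin is not in [st_smallprim]. *)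
  suff -> : it_sr (get_item s u) == Some r by [].
  have mm g' : is_small (get_group s g') ->
      mirror (get_group s g') k \in g_stby (get_group s g') k.
    by move=> sm'; rewrite mem_nth // (wf_stby W) sm'.
  case: (wf_item W (ltn_ord u)) => [r' er' rlt' e'|g' q' G' _ ns' qlt' e'].
    have [sm' _] := wf_sr W rlt'.
    rewrite er'; apply/eqP; congr Some; apply: (wf_sr_inj W) => //.
      apply: (@wf_disj _ W _ _ (mirror (get_group s g) k)).
        rewrite -us /stbys e' replica_bins_lift.
        by apply: (@stby_group_bins _ _ k); apply: mm.
      by apply: (@stby_group_bins _ _ k); apply: mm.
    by rewrite -up e' replica_bins0.
  have qij' := leq_trans qlt' (wf_count W g').
  have j0' : (0 < (g_class G').2)%N.
    by move: qij'; rewrite -/G'; case: (_.2) => //; rewrite muln0.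
  have : nth 0%N (g_prim G') (q' %% (g_class G').2) \in g_prim G'.
    by rewrite mem_nth // (wf_prim W ns') ltn_mod.
  have := e' ord0; rewrite replica_bins0 => <- /(wf_sp_reg W ns').
  by rewrite up sp.
have qij := leq_trans qlt (wf_count W g).
have j0 : (0 < (g_class G).2)%N.
  by move: qij; rewrite -/G; case: (_.2) => //; rewrite muln0.
have zlt : (q %/ (g_class G).2 < (g_class G).1)%N by rewrite ltn_divLR.
rewrite e replica_bins0 /stbys e replica_bins_lift.
have := wf_unit W k ns qij; rewrite qlt => ub.
apply: le_trans (lerD (wf_reg_stby W k ns zlt) (ler_wpM2l ei ub)) _.
rewrite -/G; set D := _ + eta - 1.
have j1 : 1 <= (g_class G).2%:R :> R by rewrite ler1n.
have D0 : 0 < D by rewrite /D; lra.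
(* One promoted item needs exactly the space reserved in a regular standby bin, so it remains to see
   that the bin holds at most [j] items. *)
have -> : (1 - eta^-1) * (eta / D) = (eta - 1) / D.
  by field; rewrite !gt_eqF.
rewrite -mulrDl ler_pdivrMr // mul1r /D -addrA lerD2r ler_nat.
exact: count_divn_eq.
Qed.

(** Any replica found in [b] reveals the kind of the bin: standby, primary for small items, or
    primary for regular ones, where at most [i] items of size at most [1 / i] meet. A bin without
    replicas has load 0. *)
Lemma placed_load_le1 s b : 1 < eta -> wf s -> placed_load s b <= 1.
Proof.
move=> e1 W; have e0 : 0 < eta by apply: lt_trans e1.
have ei : 0 <= 1 - eta^-1 by rewrite subr_ge0 invf_le1 // ltW.
case: (pickP (fun tk : 'I_(size (st_items s)) * 'I_f.+1 =>
    it_bin (get_item s tk.1) tk.2 == b)) => [[t k] /= /eqP <-|no]; last first.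
  rewrite placed_load0 // => t k lt.
  exact: (negbT (no (Ordinal lt, k))).
case: (unliftP ord0 k) => [k'|] ->.
  apply: le_trans (stby_bound k' e1 W (ltn_ord t)).
  rewrite lerDl mulr_ge0 // sumr_ge0 // => u _; exact: (wf_size W).
case: (wf_item W (ltn_ord t)) => [r er rlt e|g q G er ns qlt e].
  by rewrite e replica_bins0; apply: (wf_sp_load W); case: (wf_sr W rlt).
have qij := leq_trans qlt (wf_count W g).
have j0 : (0 < (g_class G).2)%N.
  by move: qij; rewrite -/G; case: (_.2) => //; rewrite muln0.
have i0 : (0 < (g_class G).1)%N.
  by move: qij; rewrite -/G; case: (_.1).
rewrite e replica_bins0.
have wlt : (q %% (g_class G).2 < (g_class G).2)%N by rewrite ltn_mod.
apply: le_trans (wf_reg_prim W ns wlt) _.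
rewrite ler_pdivrMr ?ltr0n // mul1r ler_nat; apply: count_modn_eq => //.
exact: (wf_count W).
Qed.

Lemma item_stbys_inj s t : wf s -> (t < size (st_items s))%N ->
  injective (stbys (get_item s t)) /\
  it_bin (get_item s t) ord0 \notin codom (stbys (get_item s t)).
Proof.
move=> W lt; have [hp [g [z [zlt e]]]] := item_row W lt; split.
  exact: eq_inj (row_inj W zlt) (fsym e).
by rewrite (eq_codom e) (row_disj W zlt).
Qed.

Lemma item_bin_inj s t : wf s -> (t < size (st_items s))%N ->
  injective (it_bin (get_item s t)).
Proof.
move=> W lt; have [sI pm] := item_stbys_inj W lt.
apply: eq_inj (replica_bins_inj sI pm) _ => k.
by case: (unliftP ord0 k) => [k'|] ->; rewrite ?replica_bins_lift ?replica_bins0.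
Qed.

Lemma canon_valid s : 1 < eta -> wf s -> uniq (st_failed s) ->
  (size (st_failed s) <= f)%N ->
  valid eta s (canon s) /\ sr_uniform s (canon s).
Proof.
move=> e1 W uF sF; split; [split|].
- move=> t lt; have [sI pm] := item_stbys_inj W lt.
  case: (boolP (it_bin (get_item s t) ord0 \in st_failed s)) => pF.
    have [k pr kF] := promoted_exists uF sF sI pF pm.
    by exists (lift ord0 k); rewrite // /canon liftK.
  by exists ord0; rewrite // /canon unlift_none.
- move=> b; case: (@load_canon _ _ eta s b e1 uF sF).
  + exact: wf_size.
  + by move=> t; apply: item_bin_inj.
  (* A shared standby bin forces the same group, then the same position [k], then the same row,
     since the list [g_stby G k] has no repetition. *)
  + move=> t t' k k' lt lt'.
    have [_ [g [z [zlt e]]]] := item_row W lt.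
    have [_ [g' [z' [zlt' e']]]] := item_row W lt'.
    rewrite e e' => eb.
    have h := mem_nth 0%N (zlt k); have h' := mem_nth 0%N (zlt' k').
    rewrite -eb in h'.
    have eg := wf_disj W (stby_group_bins h) (stby_group_bins h').
    rewrite -{}eg in e' zlt' eb h'.
    have ek := stby_inj (wf_uniq W g) h h'; split=> // l.
    rewrite -ek in eb; rewrite e e'; congr nth.
    by move/eqP: eb; rewrite nth_uniq ?(uniq_stby k (wf_uniq W g)) // => /eqP.
  + by move/le_trans; apply; apply: placed_load_le1.
  + by case=> t [k [lt <- /le_trans]]; apply; apply: stby_bound.
- by move=> t; apply: item_bin_inj.
move=> t t' r lt lt' er er' k.
case: (wf_item W lt) => [r1|? ?]; rewrite er // => -[<-] _ e.
case: (wf_item W lt') => [r2|? ?]; rewrite er' // => -[<-] _ e'.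
rewrite /canon; case: (unlift ord0 k) => // k'.
rewrite e e' !replica_bins0; apply: eq_promoted => l.
by rewrite /stbys e e'.
Qed.

(** * Events *)

(** The predicate [P] allows one class to be left out ([predC1 c]) between the moment its active
    group is completed or hit by a failure and the selection of a new one. *)
Definition active_ok s (P : pred (nat * nat)) :=
  forall c g, P c -> st_active s c = Some g -> selectable s c g.

Definition inv s := [/\ wf s, active_ok s predT, uniq (st_failed s)
                      & (size (st_failed s) <= f)%N].

Definition nonempty_class (c : nat * nat) :=
  small_class c || (0 < c.1)%N && (0 < c.2)%N.

(** When a failure triggers a selection there is no arriving item to vouch for the class; its
    positivity is read off the former active group, which has room for an item. *)
Lemma selectable_pos s c g : wf s -> selectable s c g -> nonempty_class c.
Proof.
move=> W /and4P[lt /eqP ec ninc _]; rewrite /nonempty_class.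
case: (boolP (small_class c)) => //= ns.
have := wf_incomplete W lt; rewrite /is_small ec => /(_ ns ninc).
by case: (c.1) (c.2) => [|?] [|?]; rewrite ?muln0.
Qed.

Lemma eq_selectable s s' c g : st_failed s' = st_failed s ->
  get_group s' g = get_group s g ->
  (size (st_groups s) <= size (st_groups s'))%N ->
  selectable s c g -> selectable s' c g.
Proof.
move=> eF eG le /and4P[lt ec ninc av]; apply/and4P; rewrite eG; split=> //.
  exact: leq_trans le.
by rewrite /available eF.
Qed.

Lemma select_ok s c s' : 1 < eta -> wf s -> active_ok s (predC1 c) ->
  nonempty_class c -> select s c s' ->
  [/\ wf s', active_ok s' predT, st_failed s' = st_failed s,
      st_items s' = st_items s & exists g, st_active s' c = Some g].
Proof.
move=> e1 W act cpos [g sel|G none fr].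
  split=> //; [exact: wf_set_active| |by exists g; rewrite /= eqxx].
  move=> c' g' _ /=; case: eqP => [->[<-]|/eqP ne h]; first exact: sel.
  exact: (act c' g' ne h).
have W' : wf (add_group s G).
  by apply: wf_add_group fr _ => //; move: cpos; rewrite /nonempty_class => /orP[->|].
split=> //; [exact: wf_set_active| |by exists (size (st_groups s)); rewrite /= eqxx].
have [[ec ecnt eo ecmp] _ _ _ /allP frb] := fr.
move=> c' g' _ /=; case: eqP => [->[<-]|/eqP ne h].
  apply/and4P; rewrite -/(get_group (add_group s G) _) /=.
  have -> : get_group (set_active (add_group s G) c (size (st_groups s)))
      (size (st_groups s)) = G by rewrite [LHS]get_group_add eqxx.
  rewrite size_rcons ltnSn ec ecmp eqxx; split=> //.
  by apply/allP => b /frb /andP[].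
have sel := act c' g' ne h.
apply: eq_selectable sel => //=; last by rewrite size_rcons.
have lt : (g' < size (st_groups s))%N by case/andP: (act c' g' ne h).
by rewrite [LHS]get_group_add ltn_eqF.
Qed.

Lemma ensure_active_ok s c s' : 1 < eta -> wf s -> active_ok s predT ->
  nonempty_class c -> ensure_active s c s' ->
  [/\ wf s', active_ok s' predT, st_failed s' = st_failed s,
      st_items s' = st_items s & exists g, st_active s' c = Some g].
Proof.
move=> e1 W act cpos; rewrite /ensure_active; case E: (st_active s c) => [g|].
  by move->; split=> //; exists g.
by apply: select_ok => // c' g' _; apply: act.
Qed.

(** What [canon] needs to know about an arrival: no promotion is due for the new item, and the data
    of the old items is untouched. *)
Definition arrival s s' :=
  st_failed s' = st_failed s /\
  exists2 it, st_items s' = rcons (st_items s) it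
            & it_bin it ord0 \notin st_failed s.

(** An active group has the class it is active for, so the modified group [g] is active for no class
    other than [c]. *)
Lemma active_ok_set s s' c g G : st_failed s' = st_failed s ->
  st_active s' = st_active s -> st_groups s' = st_groups (set_group s g G) ->
  st_active s c = Some g -> active_ok s predT -> active_ok s' (predC1 c).
Proof.
move=> eF ea eg ag act c' g' ne; rewrite ea => h.
have /and4P[lt /eqP ec _ _] := act c g isT ag.
apply: (eq_selectable eF) (act c' g' isT h); last first.
  by rewrite eg size_set_group.
rewrite /get_group eg nth_set_nth /=; case: eqP => // e.
have /and4P[_ /eqP ec' _ _] := act c' g' isT h.
by rewrite -ec' -ec e /= eqxx in ne.
Qed.

Lemma get_group_put_regular s g x g' (G := get_group s g) :
  get_group (put_regular s g x) g' =
  if g' == g then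
    Defs.Group (g_class G) (g_prim G) (g_stby G) (g_count G).+1 (g_open G)
               ((g_count G).+1 == (g_class G).1 * (g_class G).2)%N
  else get_group s g'.
Proof. rewrite put_regularE; exact: get_group_set. Qed.

Lemma pack_regular_ok s c x s' : 1 < eta -> wf s -> active_ok s predT ->
  ~~ small_class c -> 0 <= x -> x <= c.1%:R^-1 ->
  x / eta <= (c.2%:R + eta - 1)^-1 -> pack_regular s c x s' ->
  [/\ wf s', active_ok s' predT & arrival s s'].
Proof.
move=> e1 W act ns x0 xp xs [g ag] /=.
have sel := act c g isT ag; have /and4P[lt /eqP ec ninc av] := sel.
have tlt : (g_count (get_group s g) < c.1 * c.2)%N.
  by have := wf_incomplete W lt; rewrite /is_small ec; apply.
have cpos := selectable_pos W sel.
have j0 : (0 < c.2)%N by move: cpos; rewrite /nonempty_class (negPf ns) => /andP[].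
have W1 : wf (put_regular s g x).
  by apply: wf_put_regular; rewrite // /is_small ec.
have act1 : active_ok (put_regular s g x) (predC1 c).
  by apply: active_ok_set ag act; rewrite put_regularE.
have arr : arrival s (put_regular s g x).
  rewrite put_regularE; split=> //; eexists; first by [].
  rewrite /= replica_bins0; apply: (allP av).
  by apply/prim_group_bins/mem_nth; rewrite (wf_prim W) /is_small ec // ltn_mod.
case: ifP => [_ h|/negbT ninc'].
  have [W' act' eF ei _] := select_ok e1 W1 act1 cpos h; split=> //.
  by case: arr => eF1 [it ei1 it0]; split; [rewrite eF|exists it; rewrite ?ei].
move->; split=> // c' g' _ h; case: (eqVneq c' c) => [e|ne]; last exact: act1.
have eg : g' = g.
  by move: h; rewrite e put_regularE /= ag => -[].
rewrite e eg; apply/and4P; rewrite ninc'.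
have gE := get_group_put_regular s g x g; rewrite eqxx in gE.
split; rewrite ?gE ?ec //=.
  by rewrite put_regularE size_set_group.
by move: av; rewrite /available put_regularE.
Qed.

(** By induction on the derivation, since [PackNext] processes the item again with another group;
    the failed bins and the items do not change before the item is finally placed. *)
Lemma pack_small_ok s c x s' : 1 < eta -> small_class c -> 0 <= x -> x <= cap ->
  pack_small eta c x s s' -> wf s -> active_ok s predT ->
  [/\ wf s', active_ok s' predT & arrival s s'].
Proof.
move=> e1 smc x0 xc; elim=> {s s'}.
- move=> s g r ag og fit W act.
  have /and4P[lt /eqP ec ninc av] := act c g isT ag.
  have [_ _ _ rp] := wf_open W og.
  split=> //.
    apply: wf_put_small => //; move: fit; rewrite /fits og => /andP[].
    by rewrite /cap.
  split=> //; eexists; first by [].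
  rewrite /= replica_bins0; apply: (allP av); apply: prim_group_bins.
  by rewrite rp mem_head.
- move=> s g b s1 ag _ room hb W act.
  have /and4P[lt /eqP ec ninc av] := act c g isT ag.
  have smg : is_small (get_group s g) by rewrite /is_small ec.
  have W1 : wf s1 by apply: wf_release.
  have lt1 : (g < size (st_groups s1))%N by rewrite size_set_group.
  have g1E : get_group s1 g = Defs.Group (g_class (get_group s g)) [::]
      (g_stby (get_group s g)) (g_count (get_group s g)) None false.
    by rewrite [LHS]get_group_set eqxx.
  have smg1 : is_small (get_group s1 g) by rewrite g1E.
  have [bF bG bsr bload] : [/\ b \notin st_failed s,
      (forall g', b \notin group_bins (get_group s1 g')),
      (forall r, (r < size (st_srs s1))%N -> sr_bin (sr_at s1 r) = b ->
         sr_group (sr_at s1 r) <> g) &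
      placed_load s1 b + cap <= 1].
    case: hb => [/and4P[/andP[bsp bpr] bF room' sh]|[_ /andP[bU bF]]]; split=> //.
    + move=> g'; rewrite mem_group_bins; apply/negP => /orP[h|/existsP[k h]].
        case: (ltnP g' (size (st_groups s1))) => lt'; last first.
          by rewrite get_group_default in h.
        by have := elimT (all_nthP (group0 f)) bpr _ lt'; rewrite h.
      by have := wf_sp_stby W1 h; rewrite bsp.
    + move=> r rlt e eg; have := elimT (all_nthP (SR 0 0)) sh r rlt.
      by rewrite e eg !eqxx.
    + by move: room'; rewrite /free_space -/cap lerBrDr addrC.
    + by move=> g'; apply: contra bU; apply: (wf_used W1).
    + move=> r rlt e; case: (wf_sr W1 rlt) => _.
      by rewrite e => /(wf_sp_used W1); rewrite (negPf bU).
    + by rewrite placed_load_unused // add0r cap_le1.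
  have mload k : placed_load s1 (mirror (get_group s1 g) k) + cap <= 1.
    have := forallP room k.
    by rewrite cap_stby // /free_space /mirror g1E lerBrDr addrC.
  have W2 : wf (open_sr s1 g b) by apply: wf_open_sr.
  have g2E : get_group (open_sr s1 g b) g = Defs.Group (g_class (get_group s1 g))
      [:: b] (g_stby (get_group s1 g)) (g_count (get_group s1 g))
      (Some (size (st_srs s1))) (g_complete (get_group s1 g)).
    by rewrite [LHS]get_group_set eqxx.
  have W3 : wf (put_small (open_sr s1 g b) g (size (st_srs s)) x).
    apply: wf_put_small => //; first by rewrite g2E.
    by rewrite [sr_content _ _](sr_content_new W1) // add0r.
  split=> //.
    have act1 : active_ok s1 (predC1 c) by apply: active_ok_set ag act.
    move=> c' g' _ h; case: (eqVneq c' c) => [e|ne].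
      have -> : g' = g by move: h; rewrite e /= ag => -[].
      rewrite e; apply/and4P; rewrite -/(get_group (open_sr s1 g b) g).
      have -> : get_group (put_small (open_sr s1 g b) g (size (st_srs s)) x) g =
        get_group (open_sr s1 g b) g by [].
      rewrite g2E g1E; split=> //=.
      + by rewrite !size_set_nth !(maxn_idPr _) ?size_set_nth ?(maxn_idPr _).
      + by rewrite ec.
      + rewrite /available /group_bins /= bF; apply/allP => d hd; apply: (allP av).
        by rewrite mem_cat hd orbT.
    have h1 := act1 c' g' ne h; apply: eq_selectable h1 => //.
      rewrite [LHS]get_group_set; case: eqP => // eg.
      have /and4P[_ /eqP ec' _ _] := act c' g' isT h.
      by move: ne; rewrite -ec' eg ec eqxx.
    by rewrite /= [leqRHS]size_set_nth leq_maxr.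
  split=> //; eexists; first by [].
  rewrite /= replica_bins0 nth_rcons.
  by rewrite ltnn eqxx.
- move=> s g s1 s' ag _ _ sel ps IH W act.
  have /and4P[lt /eqP ec ninc av] := act c g isT ag.
  have smg : is_small (get_group s g) by rewrite /is_small ec.
  have W1 : wf (release s g true) by apply: wf_release.
  have act1 : active_ok (release s g true) (predC1 c).
    by apply: active_ok_set ag act.
  have cpos : nonempty_class c by rewrite /nonempty_class smc.
  have [W' act' eF ei _] := select_ok e1 W1 act1 cpos sel.
  have [W2 act2 [eF2 [it ei2 it0]]] := IH W' act'; split=> //.
  by split; [rewrite eF2 eF|exists it; rewrite ?ei2 ?ei // -[st_failed s]eF].
Qed.

(** The last standby class must be excluded. Its threshold times [eta] equals the primary threshold
    [(7 - eta^-1)^-1], and every regular item is strictly larger than that. *)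
Lemma regular_class_bounds x i j : 1 < eta -> primary_class eta x i ->
  standby_class eta (x / eta) j -> ~~ small_class (i, j) ->
  [/\ (0 < i)%N, (0 < j)%N, x <= i%:R^-1 & x / eta <= (j%:R + eta - 1)^-1].
Proof.
move=> e1 pc sc ns; have e0 : 0 < eta by apply: lt_trans e1.
have ei1 : eta^-1 < 1 by rewrite invf_lt1.
have [i0 xlow xup] : [/\ (0 < i)%N, (7 - eta^-1)^-1 < x & x <= i%:R^-1].
  case/or3P: pc => [/andP[/andP[i1 i5] /andP[lo up]]|/andP[/eqP-> /andP[lo up]]|].
  - split=> //; apply: le_lt_trans lo; rewrite lef_pV2 ?posrE; try lra.
      have : i.+1%:R <= 6%:R :> R by rewrite ler_nat.
      by lra.
    by rewrite ltr0n.
  - by split.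
  - by move=> /andP[/eqP e _]; rewrite /small_class /= e in ns.
have m6 : (6 <= nstandby eta)%N.
  by rewrite /nstandby truncn_ge_nat; lra.
case/or3P: sc => [/andP[/andP[j1 _] /andP[_ up]]|/andP[/eqP-> /andP[_ up]]|].
- by split.
- by split=> //; apply: leq_trans m6.
move=> /andP[_]; rewrite ler_pdivrMr // => h; exfalso.
suff e : (7 * eta - 1)^-1 * eta = (7 - eta^-1)^-1 by move: h; rewrite e; lra.
by field; rewrite !gt_eqF //; lra.
Qed.

(** The threshold for small items is half of [cap], so an empty SR holds any of them. *)
Lemma small_class_bounds x i j : 1 < eta -> primary_class eta x i ->
  small_class (i, j) -> x <= cap.
Proof.
move=> e1 pc /eqP /= ei; have e0 : 0 < eta by apply: lt_trans e1.
have ei1 : eta^-1 < 1 by rewrite invf_lt1.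
have p : 0 < (7 - eta^-1)^-1 by rewrite invr_gt0; lra.
rewrite ei in pc; case/or3P: pc => // /andP[_ h].
by apply: le_trans h _; rewrite /cap; lra.
Qed.

Lemma step_ok s e s' : 1 < eta -> inv s -> step eta s e s' ->
  inv s' /\ (if e is Arrive _ then arrival s s' else True).
Proof.
move=> e1 [W act uF sF] [].
- move=> x i j s1 s2 /andP[x0 _] pc sc ns ens pk.
  have [i0 j0 xp xs] := regular_class_bounds e1 pc sc ns.
  have cpos : nonempty_class (i, j) by rewrite /nonempty_class /= i0 j0 orbT.
  have [W1 act1 eF ei _] := ensure_active_ok e1 W act cpos ens.
  have [W2 act2 [eF2 [it ei2 it0]]] := pack_regular_ok e1 W1 act1 ns (ltW x0) xp xs pk.
  split; first by split; rewrite ?eF2 ?eF.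
  by split; [rewrite eF2|exists it; rewrite -?ei -?eF].
- move=> x i j s1 s2 /andP[x0 _] pc sc sm ens pk.
  have cpos : nonempty_class (i, j) by rewrite /nonempty_class sm.
  have [W1 act1 eF ei _] := ensure_active_ok e1 W act cpos ens.
  have [W2 act2 [eF2 [it ei2 it0]]] :=
    pack_small_ok e1 sm (ltW x0) (small_class_bounds e1 pc sm) pk W1 act1.
  split; first by split; rewrite ?eF2 ?eF.
  by split; [rewrite eF2|exists it; rewrite -?ei -?eF].
- move=> b c g s2 bF sz ag bg sel; split=> //.
  have W1 : wf (set_failed s (b :: st_failed s)) by apply: wf_set_failed.
  have selc := act c g isT ag.
  have act1 : active_ok (set_failed s (b :: st_failed s)) (predC1 c).
    (* Groups are disjoint, so the failed bin [b] hits no active group besides that of [c]; a single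
       selection repairs everything. *)
    move=> c' g' ne h; have /and4P[lt ec ninc av] := act c' g' isT h.
    apply/and4P; split=> //; apply/allP => d hd /=; rewrite inE negb_or.
    rewrite (allP av) // andbT; apply: contra ne => /eqP db.
    rewrite db in hd; have eg := wf_disj W hd bg.
    by rewrite -(eqP ec) eg; case/and4P: selc.
  have [W2 act2 eF _ _] := select_ok e1 W1 act1 (selectable_pos W selc) sel.
  by split=> //; rewrite eF //= bF.
- move=> b bF sz no; split=> //; split=> //=; [exact: wf_set_failed| |by rewrite bF].
  move=> c g _ h; have /and4P[lt ec ninc av] := act c g isT h.
  apply/and4P; split=> //; apply/allP => d hd /=; rewrite inE negb_or.
  by rewrite (allP av) // andbT; apply: contraNneq (no c g h) => <-.
- move=> b bF; split=> //; split=> /=; [exact: wf_set_failed| |exact: rem_uniq|].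
    move=> c g _ h; have /and4P[lt ec ninc av] := act c g isT h.
    apply/and4P; split=> //; apply/allP => d hd /=.
    by apply: contra (allP av d hd); apply: mem_rem.
  by rewrite size_rem // (leq_trans (leq_pred _)).
Qed.

Lemma canon_arrival s s' t : arrival s s' -> (t < size (st_items s'))%N ->
  canon s' t =1 if t == size (st_items s) then @placed_status f t else canon s t.
Proof.
move=> [eF [it ei it0]]; rewrite ei size_rcons ltnS leq_eqVlt => tlt k.
have gE : get_item s' t = if t == size (st_items s) then it else get_item s t.
  by rewrite -get_item_add /get_item ei.
rewrite /canon gE eF; case: eqP => // _; rewrite /placed_status.
case: (unliftP ord0 k) => [k' ->|->]; last by rewrite eqxx.
by rewrite /promoted (negPf it0) andFb [RHS]eq_sym (negPf (neq_lift _ _)).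
Qed.

Lemma eq_status_load s (sigma tau : status f) b :
  (forall t, (t < size (st_items s))%N -> sigma t =1 tau t) ->
  load eta s sigma b = load eta s tau b.
Proof.
move=> h; apply: eq_bigr => t _; apply: eq_bigr => k _; by rewrite h.
Qed.

Definition canon_adjustment : adjustment R f := fun h =>
  if h is (_, s) :: _ then canon s else @placed_status f.

(** The agreement is limited to existing items: beyond them [canon] reads the default item, whereas
    the status of the run may be inherited from earlier states. *)
Lemma run_inv (h : history R f) s (sigma : status f) : 1 < eta ->
  run eta canon_adjustment h s sigma ->
  inv s /\ forall t, (t < size (st_items s))%N -> sigma t =1 canon s t.
Proof.
move=> e1; elim=> {h s sigma} [|h s sigma e s' _ [I sc] st].
  by split=> //; split=> //; apply: wf_init.
have [I' arr] := step_ok e1 I st; split=> // t lt k.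
case: e st arr => [x|b|b] st arr //=.
rewrite (canon_arrival arr lt); case: eqP => // ne; apply: sc.
case: arr => _ [it ei _]; move: lt; rewrite ei size_rcons ltnS leq_eqVlt.
by case: eqP.
Qed.

End Invariant.

Theorem theorem1 (R : realType) (f : nat) (eta : R) (hf : (1 < f)%N)
    (heta : 1 < eta) :
  exists A : adjustment R f,
    forall (h : history R f) (s : state R f) (sigma : status f),
      run eta A h s sigma -> valid eta s sigma /\ sr_uniform s sigma.
Proof.
exists (@canon_adjustment R f) => h s sigma /(run_inv heta)[[W act uF sF] e].
have [[av ld inj] un] := canon_valid heta W uF sF; split; [split|] => //.
- by move=> t lt; have [k sk kF] := av t lt; exists k; rewrite // e.
- by move=> b; rewrite (eq_status_load eta b e).
- by move=> t t' r lt lt' er er' k; rewrite !e //; apply: un er er' k.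
Qed.
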